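(* Let $\Delta$ be the clique complex of a chordal graph with at least two maximal cliques, with facets $S_1,\ldots,S_e$ in a fixed leaf order, facet cardinalities $n_m=|S_m|$, separator cardinalities $r_1,\ldots,r_{e-1}$, and number of vertices $N$. Let $-1\le k<N-3$. The graded Betti numbers of $\mathbb K[(\Delta^\vee)_{(k)}]$ satisfy the following statements. (i) If $j<k+1$, then $\beta_{i,i+j}(\mathbb K[(\Delta^\vee)_{(k)}])=\beta_{i,i+j}(\mathbb K[\Delta^\vee])$. (ii) If $j>k+1$, then $\beta_{i,i+j}(\mathbb K[(\Delta^\vee)_{(k)}])=0$. (iii) For every $i\ge1$, $$\begin{aligned}\beta_{i,i+k+1}(\mathbb K[(\Delta^\vee)_{(k)}])&=\binom{N}{i+k+1}\binom{i+k}{k+1}-\sum_{m=1}^e\binom{n_m}{N-i-k-1}\binom{n_m-N+i+k}{i-1}\\&\quad+\sum_{m=1}^{e-1}\binom{r_m}{N-i-k-1}\binom{r_m-N+i+k}{i-1}+\delta_{i,1}\bigl|\{m:N-r_m=k+2\}\bigr|,\end{aligned}$$ where $\delta$ is the Kronecker delta.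
   Context: $\mathbb K$ is a field. For a finite set $X$ with $|X|=N$, put $R=\mathbb K[x:x\in X]$ with the standard grading. A simplicial complex $\Sigma$ on $X$ is a collection of subsets (faces) of $X$ closed under inclusion; elements of $X$ not lying in any face (ghost vertices) are allowed. A face $F$ has dimension $|F|-1$. The $k$-skeleton $\Sigma_{(k)}$ consists of all faces of dimension at most $k$, viewed as a complex on the same set $X$; $\Sigma_{(-1)}=\{\varnothing\}$. The Alexander dual on $X$ is $\Sigma^\vee=\{F\subseteq X:X\setminus F\notin\Sigma\}$. $I_\Sigma\subseteq R$ is generated by the monomials $\prod_{x\in A}x$ with $A\subseteq X$, $A\notin\Sigma$; $\mathbb K[\Sigma]=R/I_\Sigma$; $\beta_{i,j}$ denotes graded Betti numbers over $R$. Chordal clique complexes: let $\Delta$ be the complex of cliques of a finite chordal graph with vertex set $X$, $|X|=N$, having $e\ge2$ maximal cliques. A leaf order of its facets (maximal cliques) is an ordering $S_1,\ldots,S_e$ such that for each $m\ge2$ there is $p(m)<m$ satisfying $S_m\cap S_i\subseteq S_m\cap S_{p(m)}$ for all $i<m$; such an order exists. For $1\le m\le e-1$ the separators are $Q_m=(S_1\cup\cdots\cup S_m)\cap S_{m+1}=S_{p(m+1)}\cap S_{m+1}$ (possibly empty), and $r_m=|Q_m|$. One has $N=\sum_{m=1}^e n_m-\sum_{m=1}^{e-1}r_m$, and $\dim\Delta^\vee=N-3$. Binomial convention: $\binom ab=0$ if $a<0$, $b<0$ or $b>a$; otherwise it is the usual binomial coefficient. *)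

(* Defs.v *)
From HB Require Import structures.
From mathcomp Require Import all_boot all_order all_algebra.
From mathcomp Require Import mpoly.

Set Implicit Arguments.
Unset Strict Implicit.
Unset Printing Implicit Defensive.

Import Order.TTheory GRing.Theory Num.Theory.
Local Open Scope ring_scope.

Section Complexes.
Variable X : finType.
Implicit Types (Sigma : {set {set X}}) (F : {set X}).

(* Faces may have dimension -1, hence the integer-valued dimension. *)
Definition face_dim F : int := #|F|%:Z - 1.

Definition skeleton Sigma (k : int) : {set {set X}} :=
  [set F in Sigma | face_dim F <= k].

Definition alexander_dual Sigma : {set {set X}} :=
  [set F : {set X} | ~: F \notin Sigma].

Definition facets Sigma : {set {set X}} :=
  [set F | maxset (mem Sigma) F].

Definition simple_graph (adj : rel X) : Prop :=
  ssrbool.symmetric adj /\ irreflexive adj.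

(* Every cycle of length at least four has a chord, i.e. an edge joining two
   vertices that are not consecutive on the cycle. *)
Definition chordal (adj : rel X) : Prop :=
  forall s : seq X, ucycle adj s -> (4 <= size s)%N ->
    exists x y, [/\ x \in s, y \in s, adj x y, y != next s x & x != next s y].

Definition clique_complex (adj : rel X) : {set {set X}} :=
  [set C : {set X} | [forall x in C, forall y in C, (x != y) ==> adj x y]].

(* Sequences are indexed from 0: the facet S_m is [nth set0 S (m - 1)]. *)
Definition leaf_order Sigma (S : seq {set X}) : Prop :=
  [/\ uniq S, S =i facets Sigma
    & forall m, (0 < m < size S)%N ->
        exists2 p, (p < m)%N & forall i, (i < m)%N ->
          nth set0 S m :&: nth set0 S i \subset nth set0 S m :&: nth set0 S p].

(* [separator S m], for m < (size S).-1, is the separator Q_(m + 1). *)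
Definition separator (S : seq {set X}) (m : nat) : {set X} :=
  (\bigcup_(i < m.+1) nth set0 S i) :&: nth set0 S m.+1.

Variable K : fieldType.

(* The variables of R = K[x : x in X] are indexed by 'I_#|X|, through the
   enumeration of X. *)
Definition face_monomial F : {mpoly K[#|X|]} := \prod_(x in F) 'X_(enum_rank x).

Definition SR_ideal Sigma (f : {mpoly K[#|X|]}) : Prop :=
  exists c : {set X} -> {mpoly K[#|X|]},
    f = \sum_(A : {set X} | A \notin Sigma) c A * face_monomial A.

End Complexes.

(* Homogeneous of degree d; the zero polynomial is so for every integer d, and
   it is the only one when d < 0. *)
Definition homogeneous (K : fieldType) (n : nat) (d : int) (f : {mpoly K[n]}) :
  Prop := forall m, m \in msupp f -> (mdeg m)%:Z = d.

(* Minimal graded free resolutions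
     ... -> F_1 -> F_0 -> R/I -> 0,    F_i = \bigoplus_(a < rk i) R(- deg i a),
   of the cyclic module R/I, for R = {mpoly K[n]} and I a homogeneous ideal.
   Elements of F_i are row vectors, on which the differentials act by right
   multiplication, so that the image of the a-th basis vector of F_(i+1) is
   the a-th row of [mfr_diff i].  The map F_0 -> R/I is represented by lifts to
   R of the images of the basis vectors; these lifts may be chosen homogeneous
   since I is. *)
Record min_graded_free_res (K : fieldType) (n : nat)
    (I : {mpoly K[n]} -> Prop) := MinGradedFreeRes {
  mfr_rank : nat -> nat;
  mfr_deg : forall i, 'I_(mfr_rank i) -> int;
  mfr_aug : 'cV[{mpoly K[n]}]_(mfr_rank 0);
  mfr_diff : forall i, 'M[{mpoly K[n]}]_(mfr_rank i.+1, mfr_rank i);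
  mfr_aug_homog : forall a, homogeneous (mfr_deg a) (mfr_aug a 0);
  mfr_diff_homog : forall i a b,
    homogeneous (mfr_deg a - mfr_deg b) (mfr_diff i a b);
  mfr_aug_surj : forall f, exists v : 'rV_(mfr_rank 0),
    I (f - (v *m mfr_aug) 0 0);
  mfr_exact0 : forall v : 'rV_(mfr_rank 0),
    I ((v *m mfr_aug) 0 0) <-> exists w, v = w *m mfr_diff 0;
  mfr_exactS : forall i (v : 'rV_(mfr_rank i.+1)),
    v *m mfr_diff i = 0 <-> exists w, v = w *m mfr_diff i.+1;
  (* minimality: the entries lie in the irrelevant maximal ideal *)
  mfr_minimal : forall i a b, (mfr_diff i a b)@_0%MM = 0
}.

(* beta_{i,j}: the number of copies of R(-j) in F_i. *)
Definition betti (K : fieldType) (n : nat) (I : {mpoly K[n]} -> Prop)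
    (F : min_graded_free_res I) (i : nat) (j : int) : nat :=
  #|[set a : 'I_(mfr_rank F i) | mfr_deg a == j]|.

(* Binomial coefficients of integers, zero unless 0 <= b <= a. *)
Definition binomz (a b : int) : nat :=
  if (a, b) is (Posz p, Posz q) then 'C(p, q) else 0%N.

(* Main.v *)
Require Import Defs.
From mathcomp Require Import all_boot all_order all_algebra.
From mathcomp Require Import zify ring.
From mathcomp Require Import mpoly.

Set Implicit Arguments.
Unset Strict Implicit.
Unset Printing Implicit Defensive.

Import Order.TTheory GRing.Theory Num.Theory.
Local Open Scope ring_scope.

(** The proof rests on the fact that Betti numbers of Stanley-Reisner rings can be
    read off the squarefree part of a Koszul complex.

    For any minimal graded free resolution F of R/I, with I the ideal of a
    simplicial complex, beta_(i, d) counts the generators of degree d of F_i,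
    and these form a basis of Tor_i(R/I, K)_d.  This is also the homology of the
    Koszul complex with coefficients in R/I.  The isomorphism between the two is
    made explicit by zigzags in the double complex of F and the Koszul complex:
    a generator is the start of a zigzag ([zigzag_exists]), every Koszul cycle is
    the end of one ([zigzag_of_cycle]), and being zero in homology is transported
    both ways ([zigzag_reflects_boundary], [zigzag_preserves_boundary]).  The
    Koszul complex is moreover contractible in each multidegree where some vertex
    has exponent at least 2 ([sqf_part0_boundary]).  What remains is a finite
    complex of vector spaces with basis the pairs (A, B) of disjoint sets, B being
    a face, |A| the homological degree and |A| + |B| = d.  The outcome is
    [betti_rank]: beta_(i, d) plus the ranks of the two neighbouring differentials
    is the number of such pairs with |A| = i.

    Passing to the k-skeleton removes the faces with more than k + 1 elements.
    For d = i + j, the pairs with |A| = i have |B| = j.  If j < k + 1, the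
    differentials in and out of this spot only see faces with at most j + 1
    elements, so nothing changes; if j > k + 1, there are no pairs left.  In total
    degree i + k + 1 all Betti numbers but the i-th are then known, and the last
    one is determined by the Euler characteristic ([betti_skeleton_top]).  The
    correction comes from beta_2 of the dual complex: this complex has an explicit
    Hilbert-Burch resolution ([dual_res]) whose generators are the complements of
    the facets and whose syzygies are indexed by the separators, exactness being
    an elimination along the leaf order ([dual_exact1]).

    The Euler characteristic only involves the numbers of faces of the dual, that
    is, of non-faces of the clique complex.  Along the leaf order the faces with t
    elements are counted by the sum of binomials of the facets minus that of the
    separators ([card_faces]).  A single identity for partial alternating sums of
    binomials ([simplex_contribution]), applied to the simplices on X, on each
    facet and on each separator, turns this into the stated formula. *)

(** * Polynomials with prescribed coefficients *)
Section PolyTools.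
Variables (K : fieldType) (n : nat).
Implicit Types (p q : {mpoly K[n]}) (u w : 'X_{1..n}).

Definition mpoly_of b (f : 'X_{1..n} -> K) : {mpoly K[n]} :=
  \sum_(u : 'X_{1..n < b}) f u *: 'X_[u].

Lemma coef_mpoly_of b f u :
  (mpoly_of b f)@_u = if (mdeg u < b)%N then f u else 0.
Proof.
case: ltnP => [lt_ub|le_bu]; first exact: mcoeff_mpoly.
rewrite raddf_sum big1 //= => w _; rewrite mcoeffZ mcoeffX.
case: eqP => [def_u|_]; last by rewrite mulr0.
by have := bmdeg w; rewrite def_u ltnNge le_bu.
Qed.

Lemma coef_ge_msize p u : (msize p <= mdeg u)%N -> p@_u = 0.
Proof. by move=> le_pu; apply/eqP; rewrite mcoeff_eq0 msize_mdeg_ge. Qed.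

Definition mfilter (P : pred 'X_{1..n}) p : {mpoly K[n]} :=
  mpoly_of (msize p) (fun u => if P u then p@_u else 0).

Lemma coef_mfilter P p u : (mfilter P p)@_u = if P u then p@_u else 0.
Proof.
rewrite coef_mpoly_of; case: ltnP => // /coef_ge_msize ->.
by rewrite if_same.
Qed.

Lemma mfilterD P p q : mfilter P (p + q) = mfilter P p + mfilter P q.
Proof.
by apply/mpolyP=> u; rewrite mcoeffD !coef_mfilter mcoeffD; case: ifP; rewrite ?addr0.
Qed.

Lemma mfilter0 P : mfilter P 0 = 0.
Proof. by apply/mpolyP=> u; rewrite coef_mfilter !mcoeff0 if_same. Qed.

Lemma mfilter_sum P I (r : seq I) (Q : pred I) (F : I -> {mpoly K[n]}) :
  mfilter P (\sum_(i <- r | Q i) F i) = \sum_(i <- r | Q i) mfilter P (F i).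
Proof.
by elim/big_rec2: _ => [|i q p _ <-]; rewrite ?mfilter0 ?mfilterD.
Qed.

(** Multiplying by a homogeneous polynomial shifts homogeneous components; the
    condition relating P and Q only says how P moves along the monomials of the
    second factor, so the same lemma serves every grading used below. *)
Lemma mfilterM P Q p q :
  (forall u w, w \in msupp q -> P (u + w)%MM = Q u) ->
  mfilter P (p * q) = mfilter Q p * q.
Proof.
move=> PQ; apply/mpolyP=> u; rewrite coef_mfilter !mcoeffM.
rewrite -[RHS](@if_same _ (P u)); case: ifP => Pu.
  apply: eq_bigr => -[/= k1 k2] /eqP def_u; rewrite coef_mfilter /=.
  case: (boolP ((k2 : 'X_{1..n}) \in msupp q)) => [q2|].
    by rewrite -(PQ _ _ q2) -def_u Pu.
  by rewrite -mcoeff_eq0 => /eqP->; rewrite !mulr0.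
rewrite big1 // => -[/= k1 k2] /eqP def_u; rewrite coef_mfilter /=.
case: (boolP ((k2 : 'X_{1..n}) \in msupp q)) => [q2|].
  by rewrite -(PQ _ _ q2) -def_u Pu mul0r.
by rewrite -mcoeff_eq0 => /eqP->; rewrite !mulr0.
Qed.

Lemma coefXM (i : 'I_n) p u :
  ('X_i * p)@_u = if (0 < u i)%N then p@_(u - U_(i)) else 0.
Proof.
case: ifPn => ui.
  have le_iu: (U_(i) <= u)%MM by rewrite lep1mP -lt0n.
  by rewrite mulrC -{1}(submK le_iu) addmC mcoeffMX.
apply/eqP; rewrite mcoeff_eq0 mulrC (perm_mem (msuppMX _ _)).
apply/negP => /mapP[w _ def_u]; move: ui; rewrite def_u mnmDE mnm1E eqxx.
by rewrite add1n.
Qed.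

End PolyTools.

(** * The Koszul complex and its contracting homotopies *)
Section Koszul.
Variables (K : fieldType) (X : finType).
Local Notation n := #|X|.
Local Notation R := {mpoly K[n]}.
Local Notation mon := 'X_{1..n}.
Local Notation rk := (@enum_rank X).
Implicit Types (A B : {set X}) (x y z : X) (u w : mon).

Definition kos_sign x A : K :=
  (-1) ^+ #|[set y in A | (rk y < rk x)%N]|.

Lemma kos_sign_sqr x A : kos_sign x A * kos_sign x A = 1.
Proof. by rewrite /kos_sign -expr2 sqrr_sign. Qed.

Lemma kos_signU x y A : y \notin A ->
  kos_sign x (y |: A) = (-1) ^+ (rk y < rk x)%N * kos_sign x A.
Proof.
move=> yA; rewrite /kos_sign -exprD; congr (_ ^+ _).
rewrite -!sum1_card [LHS]big_mkcond (bigD1 y) //= !inE eqxx /=.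
congr (_ + _)%N.
rewrite -big_mkcondr sum1_card; apply: eq_card => z; rewrite !inE [z \in _]inE ?inE.
by case: eqP => //= ->; rewrite (negPf yA).
Qed.

(** The sign rule behind the vanishing of the square of the Koszul
    differential. *)
Lemma kos_sign_swap x y A : x != y -> x \notin A -> y \notin A ->
  kos_sign x A * kos_sign y (x |: A) = - (kos_sign y A * kos_sign x (y |: A)).
Proof.
move=> xy xA yA; rewrite !kos_signU //.
have: rk x != rk y by rewrite (inj_eq enum_rank_inj).
rewrite -val_eqE /=; case: ltngtP => //= _ _; ring.
Qed.

(** The same rule for adding x and removing y, which makes the off-diagonal
    terms of the homotopy identity cancel. *)
Lemma kos_sign_cross x y A : x != y -> x \notin A -> y \notin A ->
  kos_sign x (y |: A) * kos_sign y (x |: A) + kos_sign x A * kos_sign y A = 0.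
Proof.
move=> xy xA yA; rewrite !kos_signU //.
have: rk x != rk y by rewrite (inj_eq enum_rank_inj).
rewrite -val_eqE /=; case: ltngtP => //= _ _; ring.
Qed.

(** The exponent of x in the multidegree of the basis element e_A x^u. *)
Definition multidegree A u x : nat := (x \in A) + u (rk x).

(** The choice depends on the multidegree only, and the Koszul differential
    preserves multidegrees: this is what makes the operator built on it below a
    homotopy.  The threshold c is 1 for the exactness of the Koszul complex, and
    2 for the reduction to squarefree multidegrees. *)
Definition deg_pick c A u : option X := [pick x | (c <= multidegree A u x)%N].

Lemma multidegree_shift A u x y : x \notin A ->
  multidegree (x |: A) u y = multidegree A (u + U_(rk x))%MM y.
Proof.
move=> xA; rewrite /multidegree !inE mnmDE mnm1E (inj_eq enum_rank_inj) eq_sym.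
by case: eqP => [<-|_] /=; rewrite ?(negPf xA); lia.
Qed.

Lemma deg_pick_shift c A u x : x \notin A ->
  deg_pick c (x |: A) u = deg_pick c A (u + U_(rk x))%MM.
Proof. by move=> xA; apply: eq_pick => y; rewrite multidegree_shift. Qed.

(** The Koszul differential and its homotopy, on coefficient functions.  The
    homotopy wedges e_A x^u with e_x and divides it by x, where x is the vertex
    picked in its multidegree, and kills it when x is already in A. *)
Definition coef_d (f : {set X} -> mon -> K) A u : K :=
  \sum_(x | x \notin A)
     if (0 < u (rk x))%N then kos_sign x A * f (x |: A) (u - U_(rk x))%MM else 0.

Definition coef_s c (f : {set X} -> mon -> K) A u : K :=
  if deg_pick c A u is Some x then
    if x \in A then kos_sign x (A :\ x) * f (A :\ x) (u + U_(rk x))%MM else 0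
  else 0.

(** In each multidegree, d s + s d is the identity as soon as a vertex x can be
    picked.  If x lies in A, the term of s d that puts x back gives f A u and
    the others cancel against d s; otherwise s d vanishes, and only the term
    of d s that removes x survives. *)
Lemma coef_homotopy c f A u : (0 < c)%N ->
  coef_d (coef_s c f) A u + coef_s c (coef_d f) A u =
    if deg_pick c A u then f A u else 0.
Proof.
move=> c_gt0; rewrite {1}/coef_d.
have pickE y : y \notin A -> (0 < u (rk y))%N ->
    deg_pick c (y |: A) (u - U_(rk y)) = deg_pick c A u.
  by move=> yA uy; rewrite deg_pick_shift // submK // lep1mP -lt0n.
have -> : \sum_(y | y \notin A) (if (0 < u (rk y))%N then
     kos_sign y A * coef_s c f (y |: A) (u - U_(rk y)) else 0) =
   \sum_(y | y \notin A) (if (0 < u (rk y))%N then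
     kos_sign y A * (if deg_pick c A u is Some x then
     if x \in y |: A then kos_sign x ((y |: A) :\ x) *
        f ((y |: A) :\ x) (u - U_(rk y) + U_(rk x))%MM else 0 else 0) else 0).
  apply: eq_bigr => y yA; case: ifP => // uy.
  by rewrite /coef_s pickE.
rewrite {1}/coef_s /deg_pick; case: pickP => [x cx|_] /=; last first.
  by rewrite big1 ?addr0 // => y _; case: ifP => // _; rewrite mulr0.
case: ifPn => xA.
- rewrite /coef_d (bigD1 (P := fun y => y \notin A :\ x) x) ?setD11 //=.
  rewrite mnmDE mnm1E eqxx addn1 /= setD1K // addmK mulrDr mulrA kos_sign_sqr mul1r.
  rewrite addrC -addrA -[RHS]addr0; congr (_ + _).
  have -> : \sum_(i | (i \notin A :\ x) && (i != x)) (if (0 < (u + U_(rk x))%MM (rk i))%N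
      then kos_sign i (A :\ x) * f (i |: A :\ x) (u + U_(rk x) - U_(rk i))%MM else 0)
    = \sum_(i | i \notin A) (if (0 < (u + U_(rk x))%MM (rk i))%N
      then kos_sign i (A :\ x) * f (i |: A :\ x) (u + U_(rk x) - U_(rk i))%MM else 0).
    by apply: eq_bigl => i; rewrite !inE; case: eqP => [->|]; rewrite ?xA // andbT.
  rewrite mulr_sumr -big_split big1 //= => y yA.
  have yx: y != x by apply: contraNneq yA => ->.
  rewrite mnmDE mnm1E (inj_eq enum_rank_inj) eq_sym (negPf yx) addn0.
  case: ifP => uy; last by rewrite mulr0 addr0.
  have -> : x \in y |: A by rewrite !inE xA orbT.
  have -> : (y |: A) :\ x = y |: (A :\ x).
    by apply/setP=> z; rewrite !inE; case: eqP => // ->; rewrite eq_sym (negPf yx).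
  have -> : (u + U_(rk x) - U_(rk y) = u - U_(rk y) + U_(rk x))%MM.
    apply/mnmP=> i; rewrite !(mnmBE, mnmDE, mnm1E).
    by case: (eqVneq (rk y) i) => [<-|_]; move: uy; rewrite ?subn0 //; case: (_ == _) => /=; lia.
  have xA' : x \notin A :\ x by rewrite setD11.
  have yA' : y \notin A :\ x by rewrite !inE negb_and yA orbT.
  have eA : kos_sign y A = kos_sign y (x |: A :\ x) by rewrite setD1K.
  rewrite !mulrA -mulrDl eA.
  by rewrite [X in X * _]addrC [X in X + _]mulrC kos_sign_cross ?mul0r 1?eq_sym.
- have ux : (0 < u (rk x))%N.
    by move: cx; rewrite /multidegree (negPf xA); lia.
  rewrite addr0 (bigD1 x) //= ux setU11 setU1K // submK; last first.
    by rewrite lep1mP -lt0n.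
  rewrite mulrA kos_sign_sqr mul1r big1 ?addr0 // => y /andP[yA yx].
  by rewrite !inE eq_sym (negPf yx) (negPf xA) /= mulr0 if_same.
Qed.

Section FreeModule.
Variable r : nat.
Local Notation kos := {ffun {set X} -> 'rV[R]_r}.
Implicit Types t : kos.

Definition kcoef t (j : 'I_r) A u : K := (t A 0 j)@_u.

Lemma kcoefP t t' : (forall j A u, kcoef t j A u = kcoef t' j A u) -> t = t'.
Proof.
by move=> E; apply/ffunP=> A; apply/rowP=> j; apply/mpolyP=> u; apply: E.
Qed.

Definition kos_coef x A : R := kos_sign x A *: 'X_(rk x).

Definition kos_d t : kos :=
  [ffun A : {set X} => \sum_(x | x \notin A) kos_coef x A *: t (x |: A)].

Lemma kcoef_d t j A u : kcoef (kos_d t) j A u = coef_d (kcoef t j) A u.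
Proof.
rewrite /kcoef ffunE summxE raddf_sum; apply: eq_bigr => x _ /=.
rewrite mxE /kos_coef -scalerAl mcoeffZ coefXM.
by case: ifP => _; rewrite ?mulr0.
Qed.

Definition kos_s c t : kos :=
  [ffun A : {set X} => \row_j mpoly_of (\max_B msize (t B 0%R j)) (coef_s c (kcoef t j) A)].

Lemma kcoef_s c t j A u : kcoef (kos_s c t) j A u = coef_s c (kcoef t j) A u.
Proof.
rewrite /kcoef ffunE mxE coef_mpoly_of; case: ltnP => // le_u.
rewrite /coef_s; case: deg_pick => // x; case: ifP => // xA.
rewrite coef_ge_msize ?mulr0 //.
have /leq_trans := leq_bigmax (F := fun B => msize (t B 0%R j)) (A :\ x).
apply; apply: (leq_trans le_u); rewrite mdegD; lia.
Qed.

Lemma kcoefD t t' j A u : kcoef (t + t') j A u = kcoef t j A u + kcoef t' j A u.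
Proof. by rewrite /kcoef ffunE mxE mcoeffD. Qed.

Lemma kcoefN t j A u : kcoef (- t) j A u = - kcoef t j A u.
Proof. by rewrite /kcoef ffunE mxE mcoeffN. Qed.

Lemma kos_homotopy c t j A u : (0 < c)%N ->
  kcoef (kos_d (kos_s c t) + kos_s c (kos_d t)) j A u =
    if deg_pick c A u then kcoef t j A u else 0.
Proof.
move=> c_gt0; rewrite kcoefD kcoef_d kcoef_s -(coef_homotopy _ _ _ c_gt0).
congr (_ + _).
  by apply: eq_bigr => x _; case: ifP => // _; rewrite kcoef_s.
rewrite /coef_s; case: deg_pick => // x; case: ifP => // _.
by rewrite kcoef_d.
Qed.

Lemma kos_dD t t' : kos_d (t + t') = kos_d t + kos_d t'.
Proof.
apply/ffunP=> A; rewrite !ffunE -big_split; apply: eq_bigr => x _.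
by rewrite ffunE scalerDr.
Qed.

Lemma kos_dZ (a : R) t : kos_d (a *: t) = a *: kos_d t.
Proof.
apply/ffunP=> A; rewrite !ffunE scaler_sumr; apply: eq_bigr => x _.
by rewrite ffunE !scalerA mulrC.
Qed.

Lemma kos_dN t : kos_d (- t) = - kos_d t.
Proof. by rewrite -scaleN1r kos_dZ scaleN1r. Qed.

Lemma kos_dB t t' : kos_d (t - t') = kos_d t - kos_d t'.
Proof. by rewrite kos_dD kos_dN. Qed.

Lemma kos_d0 : kos_d 0 = 0.
Proof. by have := kos_dB 0 0; rewrite !subrr. Qed.

(** Grouping the ordered pairs (x, y) and (y, x), rather than using
    antisymmetry of the whole sum, keeps the argument valid in
    characteristic 2. *)
Lemma kos_dd t : kos_d (kos_d t) = 0.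
Proof.
apply/ffunP=> A; rewrite !ffunE.
pose g x y : 'rV[R]_r := (kos_coef x A * kos_coef y (x |: A)) *: t (y |: (x |: A)).
pose P x y := [&& x \notin A, y \notin A & x != y].
have gC x y : P x y -> g x y + g y x = 0.
  case/and3P=> xA yA xy; rewrite /g setUCA -scalerDl.
  suff -> : kos_coef x A * kos_coef y (x |: A) + kos_coef y A * kos_coef x (y |: A) = 0.
    by rewrite scale0r.
  rewrite /kos_coef -!scalerAl -!scalerAr !scalerA [X in _ + _ *: X]mulrC -scalerDl.
  by rewrite kos_sign_swap // addNr scale0r.
transitivity (\sum_x \sum_(y | P x y) g x y).
  rewrite big_mkcond; apply: eq_bigr => x _; case: ifPn => xA; last first.
    by rewrite big_pred0 // => y; rewrite /P (negPf xA).
  rewrite ffunE scaler_sumr; apply: eq_big => y; last by rewrite scalerA.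
  by rewrite /P !inE negb_or xA eq_sym andbC.
rewrite pair_big_dep /= (bigID (fun q : X * X => (rk q.1 < rk q.2)%N)) /=.
rewrite [X in _ + X](reindex_inj (h := fun q : X * X => (q.2, q.1))) /=; last first.
  by move=> [a b] [a' b'] [-> ->].
rewrite [X in _ + X](_ : _ = \sum_(q : X * X | P q.1 q.2 && (rk q.1 < rk q.2)%N) g q.2 q.1).
  by rewrite -big_split big1 //= => -[x y] /andP[/gC].
apply: eq_bigl => -[x y] /=; rewrite /P /=.
rewrite [y == x]eq_sym; case: (eqVneq x y) => [->|xy]; rewrite ?andbF //.
have : rk x != rk y by rewrite (inj_eq enum_rank_inj).
by rewrite -val_eqE /=; do 2!case: (_ \in A) => //=; case: ltngtP.
Qed.

End FreeModule.
End Koszul.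

(** * Monomial ideals of simplicial complexes *)
Section Ideal.
Variables (K : fieldType) (X : finType).
Local Notation n := #|X|.
Local Notation R := {mpoly K[n]}.
Local Notation mon := 'X_{1..n}.
Local Notation rk := (@enum_rank X).
Implicit Types (A B : {set X}) (x y z : X) (u w : mon).

Definition down_closed (Sigma : {set {set X}}) :=
  forall A B, A \subset B -> B \in Sigma -> A \in Sigma.

Definition mon_supp u : {set X} := [set x | (0 < u (rk x))%N].

Definition sqf_mon A : mon := [multinom (enum_val i \in A : nat) | i < n].

Lemma sqf_monE A x : sqf_mon A (rk x) = (x \in A).
Proof. by rewrite mnmE enum_rankK. Qed.

Lemma mon_supp_sqf A : mon_supp (sqf_mon A) = A.
Proof. by apply/setP=> x; rewrite inE sqf_monE lt0b. Qed.

Lemma sqf_mon_le A u : (sqf_mon A <= u)%MM = (A \subset mon_supp u).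
Proof.
apply/mnm_lepP/subsetP => [le_Au x xA|sAu i].
  by have := le_Au (rk x); rewrite sqf_monE xA inE.
rewrite -[i]enum_valK sqf_monE; case: (boolP (_ \in A)) => // /sAu.
by rewrite inE.
Qed.

Lemma mdeg_sqf A : mdeg (sqf_mon A) = #|A|.
Proof.
rewrite mdegE (reindex rk) /=; last exact/onW_bij/enum_rank_bij.
transitivity (\sum_(x in A) 1)%N; last by rewrite sum1_card.
rewrite [RHS]big_mkcond; apply: eq_bigr => x _.
by rewrite sqf_monE; case: ifP.
Qed.

Lemma face_monomialE A : face_monomial K A = 'X_[sqf_mon A].
Proof.
rewrite mpolyXE_id (reindex rk) /=; last exact/onW_bij/enum_rank_bij.
rewrite /face_monomial big_mkcond; apply: eq_bigr => x _.
by rewrite sqf_monE; case: ifP; rewrite ?expr1 ?expr0.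
Qed.

Lemma coefMX (p : R) w u :
  (p * 'X_[w])@_u = if (w <= u)%MM then p@_(u - w) else 0.
Proof.
case: ifPn => le_wu; first by rewrite -{1}(submK le_wu) addmC mcoeffMX.
apply/eqP; rewrite mcoeff_eq0 (perm_mem (msuppMX _ _)).
by apply/negP => /mapP[v _ def_u]; case/negP: le_wu; rewrite def_u lem_addr.
Qed.

(** Membership in a monomial ideal is decided monomial by monomial: each
    monomial of f is attributed to one generator that divides it. *)
Lemma sqf_ideal_memP (I : finType) (P : pred I) (g : I -> {set X}) (f : R) :
    (forall u, f@_u != 0 -> exists2 a, P a & g a \subset mon_supp u) ->
  exists c : I -> R, f = \sum_(a | P a) c a * 'X_[sqf_mon (g a)].
Proof.
move=> fP; pose gen u := [pick a | P a && (g a \subset mon_supp u)].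
exists (fun a => \sum_(u : 'X_{1..n < msize f} | gen u == Some a)
           f@_u *: 'X_[(u - sqf_mon (g a))%MM]).
have -> : \sum_(a | P a) (\sum_(u : 'X_{1..n < msize f} | gen u == Some a)
    f@_u *: 'X_[(u - sqf_mon (g a))%MM]) * 'X_[sqf_mon (g a)] =
  \sum_(a | P a) \sum_(u : 'X_{1..n < msize f} | gen u == Some a) f@_u *: 'X_[u].
  apply: eq_bigr => a _; rewrite mulr_suml; apply: eq_bigr => u.
  rewrite /gen; case: pickP => // b /andP[_ sbu] /eqP[<-].
  by rewrite -scalerAl -mpolyXD submK // sqf_mon_le.
rewrite (exchange_big_dep predT) //= {1}(mpolywE (leqnn (msize f))).
apply: eq_bigr => u _; have [-> | /fP[a0 Pa0 sa0u]] := eqVneq f@_u 0.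
  by rewrite scale0r big1.
rewrite /gen; case: pickP => [a /andP[Pa _]|/(_ a0)]; last by rewrite Pa0 sa0u.
apply/esym/(big_pred1 a) => b /=; have [->|/negPf nba] := eqVneq b a.
  by rewrite Pa !eqxx.
by rewrite -[Some a == _]/(a == b) eq_sym nba andbF.
Qed.

Lemma coef_sqf_gen (c : R) A u :
  ~~ (A \subset mon_supp u) -> (c * 'X_[sqf_mon A])@_u = 0.
Proof. by move=> /negPf nAu; rewrite coefMX sqf_mon_le nAu. Qed.

Lemma SR_idealP Sigma (f : R) : down_closed Sigma ->
  SR_ideal Sigma f <-> (forall u, mon_supp u \in Sigma -> f@_u = 0).
Proof.
move=> dcS; split=> [[c ->] u uS | f0].
  rewrite raddf_sum big1 //= => A AS; rewrite face_monomialE coef_sqf_gen //.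
  by apply: contra AS => sAu; apply: dcS uS.
have [|c def_f] := @sqf_ideal_memP _ (fun A => A \notin Sigma) id f.
  move=> u fu; exists (mon_supp u) => //; apply: contra fu => uS.
  by rewrite f0.
by exists c; rewrite {1}def_f; apply: eq_bigr => A _; rewrite face_monomialE.
Qed.

End Ideal.

(** * Bihomogeneous components and exactness of the Koszul complex *)
Section KosMaps.
Variables (K : fieldType) (X : finType).
Local Notation n := #|X|.
Local Notation R := {mpoly K[n]}.
Local Notation mon := 'X_{1..n}.
Local Notation rk := (@enum_rank X).
Local Notation V r := {ffun {set X} -> 'rV[R]_r}.
Implicit Types (A B : {set X}) (x y z : X) (u w : mon).

Lemma kcoefZ r (a : K) (t : V r) j A u :
  kcoef (a%:MP *: t) j A u = a * kcoef t j A u.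
Proof. by rewrite /kcoef ffunE mxE mcoeffCM. Qed.

Definition kos_mul r r' (D : 'M[R]_(r, r')) (t : V r) : V r' :=
  [ffun A => t A *m D].

Lemma kos_mulD r r' (D : 'M[R]_(r, r')) t t' :
  kos_mul D (t + t') = kos_mul D t + kos_mul D t'.
Proof. by apply/ffunP=> A; rewrite !ffunE mulmxDl. Qed.

Lemma kos_mulZ r r' (D : 'M[R]_(r, r')) (a : R) t :
  kos_mul D (a *: t) = a *: kos_mul D t.
Proof. by apply/ffunP=> A; rewrite !ffunE scalemxAl. Qed.

Lemma kos_mulN r r' (D : 'M[R]_(r, r')) t : kos_mul D (- t) = - kos_mul D t.
Proof. by rewrite -scaleN1r kos_mulZ scaleN1r. Qed.

Lemma kos_mulB r r' (D : 'M[R]_(r, r')) t t' :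
  kos_mul D (t - t') = kos_mul D t - kos_mul D t'.
Proof. by rewrite kos_mulD kos_mulN. Qed.

Lemma kos_mul0 r r' (D : 'M[R]_(r, r')) : kos_mul D 0 = 0.
Proof. by have := kos_mulB D 0 0; rewrite !subrr. Qed.

Lemma kos_d_mul r r' (D : 'M[R]_(r, r')) t :
  kos_d (kos_mul D t) = kos_mul D (kos_d t).
Proof.
apply/ffunP=> A; rewrite !ffunE mulmx_suml; apply: eq_bigr => x _.
by rewrite ffunE scalemxAl.
Qed.

Variable d : int.

(** The component of exterior degree p and total degree d of an element of the
    Koszul complex of a free module with generators in degrees g. *)
Definition kos_proj r (g : 'I_r -> int) (p : nat) (t : V r) : V r :=
  [ffun A : {set X} => \row_j mfilter
     (fun u => (#|A| == p) && ((#|A| + mdeg u)%N%:Z + g j == d)) (t A 0 j)].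

Lemma kcoef_proj r (g : 'I_r -> int) p t j A u :
  kcoef (kos_proj g p t) j A u =
    if (#|A| == p) && ((#|A| + mdeg u)%N%:Z + g j == d) then kcoef t j A u else 0.
Proof. by rewrite /kcoef ffunE mxE coef_mfilter. Qed.

Lemma kos_proj_idem r (g : 'I_r -> int) p t :
  kos_proj g p (kos_proj g p t) = kos_proj g p t.
Proof. by apply: kcoefP => j A u; rewrite !kcoef_proj; case: (_ && _). Qed.

Lemma kos_projD r (g : 'I_r -> int) p t t' :
  kos_proj g p (t + t') = kos_proj g p t + kos_proj g p t'.
Proof.
apply: kcoefP => j A u; rewrite !(kcoef_proj, kcoefD).
by case: ifP; rewrite ?addr0.
Qed.

Lemma kos_projZ r (g : 'I_r -> int) p (a : K) t :
  kos_proj g p (a%:MP *: t) = a%:MP *: kos_proj g p t.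
Proof.
apply: kcoefP => j A u; rewrite !(kcoef_proj, kcoefZ).
by case: ifP; rewrite ?mulr0.
Qed.

Lemma kos_projB r (g : 'I_r -> int) p t t' :
  kos_proj g p (t - t') = kos_proj g p t - kos_proj g p t'.
Proof.
apply: kcoefP => j A u; rewrite !(kcoef_proj, kcoefD, kcoefN).
by case: ifP; rewrite ?subr0.
Qed.

Lemma kos_proj0 r (g : 'I_r -> int) p : kos_proj g p 0 = 0.
Proof. by have := kos_projB g p 0 0; rewrite !subrr. Qed.

Lemma kos_proj_d r (g : 'I_r -> int) p t :
  kos_d (kos_proj g p.+1 t) = kos_proj g p (kos_d t).
Proof.
apply: kcoefP => j A u; rewrite kcoef_proj !kcoef_d /coef_d.
set C := _ && _; pose F x := if (0 < u (rk x))%N then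
  kos_sign K x A * kcoef t j (x |: A) (u - U_(rk x))%MM else 0.
transitivity (\sum_(x | x \notin A) if C then F x else 0); last first.
  by case: ifP => // _; rewrite big1.
rewrite {}/C {}/F; apply: eq_bigr => x xA; case: ifP => ux; last by rewrite if_same.
have le_u : (U_(rk x) <= u)%MM by rewrite lep1mP -lt0n.
rewrite kcoef_proj cardsU1 xA -{3}(submK le_u) mdegD mdeg1 eqSS addnA addn1.
by case: ifP; rewrite ?mulr0.
Qed.

Lemma kos_proj_mul r r' (g : 'I_r -> int) (g' : 'I_r' -> int) (D : 'M[R]_(r, r'))
    p t : (forall a b, homogeneous (g a - g' b) (D a b)) ->
  kos_proj g' p (kos_mul D t) = kos_mul D (kos_proj g p t).
Proof.
move=> homD; apply/ffunP=> A; apply/rowP=> j; rewrite !ffunE !mxE mfilter_sum.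
apply: eq_bigr => a _; rewrite mxE; apply: mfilterM => u w /homD degw.
by rewrite mdegD; congr (_ && _); lia.
Qed.

(** With threshold 1 the homotopy fails to contract only the multidegree 0,
    that is, the constant coefficients in exterior degree 0. *)
Lemma kos_exact r (g : 'I_r -> int) p (t : V r) :
    kos_proj g p t = t -> kos_d t = 0 -> (forall j, kcoef t j set0 0%MM = 0) ->
  exists2 y, kos_proj g p.+1 y = y & t = kos_d y.
Proof.
move=> hom_t dt0 t00.
suff def_t : t = kos_d (kos_s 1 t).
  exists (kos_proj g p.+1 (kos_s 1 t)); first by rewrite kos_proj_idem.
  by rewrite kos_proj_d -def_t.
apply: kcoefP => j A u; have := kos_homotopy t j A u (ltn0Sn 0).
rewrite kcoefD dt0 [X in _ + X](_ : _ = 0) ?addr0 => [->|]; last first.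
  rewrite kcoef_s /coef_s; case: deg_pick => // x; case: ifP => // _.
  by rewrite /kcoef ffunE mxE mcoeff0 mulr0.
rewrite /deg_pick; case: pickP => //= no_x.
have u0 x : u (rk x) = 0%N.
  by have := no_x x; rewrite /multidegree; lia.
have -> : A = set0.
  by apply/setP=> x; have := no_x x; rewrite /multidegree inE; case: (x \in A).
have -> : u = 0%MM; last exact: t00.
by apply/mnmP=> i; rewrite -[i]enum_valK u0 mnm0E.
Qed.

Lemma kos_d_proj0 r (g : 'I_r -> int) t : kos_d (kos_proj g 0 t) = 0.
Proof.
apply: kcoefP => j A u; rewrite kcoef_d /coef_d /kcoef ffunE mxE mcoeff0 big1 //.
move=> x xA; case: ifP => // _.
have := kcoef_proj g 0 t j (x |: A) (u - U_(rk x))%MM.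
by rewrite /kcoef cardsU1 xA /= => ->; rewrite mulr0.
Qed.

End KosMaps.

(** * Zigzags between a resolution and the Koszul complex *)
Section Zigzag.
Variables (K : fieldType) (X : finType) (Sigma : {set {set X}}).
Hypothesis dcS : down_closed Sigma.
Local Notation n := #|X|.
Local Notation R := {mpoly K[n]}.
Local Notation mon := 'X_{1..n}.
Local Notation rk := (@enum_rank X).
Local Notation V r := {ffun {set X} -> 'rV[R]_r}.
Implicit Types (A B : {set X}) (u : mon).

(** Koszul chains with all coefficients in the Stanley-Reisner ideal: chains
    with coefficients in the quotient ring are treated as polynomial chains
    modulo these. *)
Definition kos_in (c : V 1) : Prop :=
  forall A u, mon_supp u \in Sigma -> kcoef c 0 A u = 0.

Lemma kos_inP (c : V 1) : kos_in c <-> forall A, SR_ideal Sigma (c A 0 0).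
Proof.
split=> [c0 A|cI A u uS]; first by apply/(SR_idealP _ dcS) => u; apply: c0.
by have /(SR_idealP _ dcS) := cI A; apply.
Qed.

Lemma kos_inD c c' : kos_in c -> kos_in c' -> kos_in (c + c').
Proof. by move=> c0 c'0 A u uS; rewrite kcoefD c0 ?c'0 ?addr0. Qed.

Lemma kos_inN c : kos_in c -> kos_in (- c).
Proof. by move=> c0 A u uS; rewrite kcoefN c0 ?oppr0. Qed.

Lemma kos_inB c c' : kos_in c -> kos_in c' -> kos_in (c - c').
Proof. by move=> c0 c'0; apply/kos_inD/kos_inN. Qed.

Lemma kos_inZ (a : K) c : kos_in c -> kos_in (a%:MP *: c).
Proof. by move=> c0 A u uS; rewrite kcoefZ c0 ?mulr0. Qed.

Lemma kos_in0 : kos_in 0.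
Proof. by move=> A u _; rewrite /kcoef ffunE mxE mcoeff0. Qed.

(** Dividing a monomial by a variable can only shrink its support. *)
Lemma kos_in_d c : kos_in c -> kos_in (kos_d c).
Proof.
move=> c0 A u uS; rewrite kcoef_d /coef_d big1 // => x xA; case: ifP => // ux.
rewrite c0 ?mulr0 //; apply: dcS uS; apply/subsetP=> y; rewrite !inE mnmBE.
lia.
Qed.

Lemma kos_in_proj d g p c : kos_in c -> kos_in (kos_proj d g p c).
Proof. by move=> c0 A u uS; rewrite kcoef_proj c0 ?if_same. Qed.

Variable F : min_graded_free_res (@SR_ideal X K Sigma).
Variable d : int.

Local Notation rank := (mfr_rank F).
Local Notation aug := (kos_mul (mfr_aug F)).
Local Notation dF q := (kos_mul (mfr_diff F q)).
Local Notation g0 := (fun _ : 'I_1 => 0 : int).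
Local Notation proj q := (kos_proj d (mfr_deg (m := F) (i := q))).
Local Notation proj0 := (kos_proj d g0).

Lemma kos_proj_aug p t : proj0 p (aug t) = aug (proj 0 p t).
Proof.
by apply: kos_proj_mul => a b; rewrite subr0 ord1; apply: mfr_aug_homog.
Qed.

Lemma kos_proj_diff q p t : proj q p (dF q t) = dF q (proj q.+1 p t).
Proof. by apply: kos_proj_mul => a b; apply: mfr_diff_homog. Qed.

Lemma kos_aug_surj (c : V 1) : exists t, kos_in (c - aug t).
Proof.
have /fin_all_exists[t tP] A := mfr_aug_surj F (c A 0 0).
exists [ffun A => t A]; apply/kos_inP => A.
by move: (tP A); rewrite !ffunE !mxE.
Qed.

Lemma kos_exact0 t : kos_in (aug t) <-> exists z : V _, t = dF 0 z.
Proof.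
rewrite kos_inP; split=> [tI | [z ->] A]; last first.
  by rewrite !ffunE; apply/mfr_exact0; exists (z A).
have /fin_all_exists[z zP] A : exists w, t A = w *m mfr_diff F 0.
  by apply/mfr_exact0; move: (tI A); rewrite ffunE.
by exists [ffun A => z A]; apply/ffunP=> A; rewrite !ffunE.
Qed.

Lemma kos_exactS q t : dF q t = 0 <-> exists z : V _, t = dF q.+1 z.
Proof.
split=> [t0 | [z ->]]; last first.
  by apply/ffunP=> A; rewrite !ffunE; apply/mfr_exactS; exists (z A).
have /fin_all_exists[z zP] A : exists w, t A = w *m mfr_diff F q.+1.
  by apply/mfr_exactS; move/ffunP/(_ A): t0; rewrite !ffunE.
by exists [ffun A => z A]; apply/ffunP=> A; rewrite !ffunE.
Qed.

Lemma kos_aug_diff t : kos_in (aug (dF 0 t)).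
Proof. by apply/kos_exact0; exists t. Qed.

Lemma kos_diff_diff q t : dF q (dF q.+1 t) = 0.
Proof. by apply/kos_exactS; exists t. Qed.

(** A zigzag joins t in F_q, tensored with exterior degree p, to a chain c with
    coefficients in R in exterior degree p + q, by alternately applying the
    differential of the resolution and lifting along the Koszul differential.
    It realises the two computations of Tor(R/I, K), from the resolution and
    from the Koszul complex.  All the intermediate chains are bihomogeneous, of
    total degree d. *)
Fixpoint zigzag q p : V (rank q) -> V 1 -> Prop :=
  match q with
  | 0 => fun t c => proj0 p c = c /\ kos_in (c - aug t)
  | q'.+1 => fun t c => exists t' : V (rank q'),
      [/\ proj q' p.+1 t' = t', dF q' t = kos_d t' & zigzag p.+1 t' c]
  end.
Arguments zigzag : clear implicits.

Lemma zigzag_lin q p (a : K) t c t' c' : zigzag q p t c -> zigzag q p t' c' ->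
  zigzag q p (a%:MP *: t + t') (a%:MP *: c + c').
Proof.
elim: q p t c t' c' => [|q IHq] p t c t' c' /=.
  move=> [hc tc] [hc' tc']; split; first by rewrite kos_projD kos_projZ hc hc'.
  rewrite kos_mulD kos_mulZ opprD addrACA -scalerBr.
  by apply: kos_inD => //; apply: kos_inZ.
move=> [s [hs ds sc]] [s' [hs' ds' sc']]; exists (a%:MP *: s + s'); split.
- by rewrite kos_projD kos_projZ hs hs'.
- by rewrite kos_mulD kos_mulZ ds ds' kos_dD kos_dZ.
- exact: IHq.
Qed.

Lemma zigzag0 q p : zigzag q p 0 0.
Proof.
elim: q p => [|q IHq] p /=.
  by rewrite kos_proj0 kos_mul0 subrr; split=> //; apply: kos_in0.
by exists 0; rewrite kos_proj0 kos_mul0 kos_d0; split.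
Qed.

Lemma zigzag_sum (I : Type) (r : seq I) (a : I -> K) q p t c :
  (forall i, zigzag q p (t i) (c i)) ->
  zigzag q p (\sum_(i <- r) (a i)%:MP *: t i) (\sum_(i <- r) (a i)%:MP *: c i).
Proof.
move=> tc; elim: r => [|i r IHr]; first by rewrite !big_nil; apply: zigzag0.
by rewrite !big_cons; apply: zigzag_lin.
Qed.

Lemma zigzagB q p t c t' c' : zigzag q p t c -> zigzag q p t' c' ->
  zigzag q p (t - t') (c - c').
Proof.
move=> tc tc'; rewrite [t - _]addrC [c - _]addrC.
have := zigzag_lin (-1) tc' tc; rewrite -[(-1)%:MP]/((- 1 : K)%:MP) mpolyCN mpolyC1.
by rewrite !scaleN1r.
Qed.

Lemma zigzag_hom q p t c : zigzag q p t c -> proj0 (p + q) c = c.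
Proof.
elim: q p t c => [|q IHq] p t c /=; first by rewrite addn0 => -[].
by case=> t' [_ _ /IHq]; rewrite addSnnS.
Qed.

Lemma kos_proj_set0 r (g : 'I_r -> int) p (t : V r) j u :
  kos_proj d g p.+1 t = t -> kcoef t j set0 u = 0.
Proof. by move=> <-; rewrite kcoef_proj cards0. Qed.

(** The condition under which a zigzag can leave t: the image of t in F_(q-1)
    has to be a Koszul boundary. *)
Definition zigzag_start q : V (rank q) -> Prop :=
  match q with
  | 0 => fun _ => True
  | q'.+1 => fun t => kos_d (dF q' t) = 0 /\ (forall j, kcoef (dF q' t) j set0 0%MM = 0)
  end.

Lemma zigzag_exists q p t : proj q p t = t -> zigzag_start t -> exists c, zigzag q p t c.
Proof.
elim: q p t => [|q IHq] p t hom_t.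
  exists (aug t); split; last by rewrite subrr; apply: kos_in0.
  by rewrite kos_proj_aug hom_t.
case=> dt0 t00.
have [|t' hom_t' dt'] := kos_exact _ dt0 t00 (g := mfr_deg (i := q)) (p := p) (d := d).
  by rewrite kos_proj_diff hom_t.
have [|c t'c] := IHq p.+1 t' hom_t'; last by exists c, t'.
case: q t t' {IHq t00 dt0 hom_t} dt' hom_t' => //= q t t' dt' hom_t'; split.
  by rewrite kos_d_mul -dt' kos_diff_diff.
move=> j; rewrite /kcoef ffunE mxE raddf_sum big1 //= => a _.
suff -> : t' set0 0 a = 0 by rewrite mul0r mcoeff0.
by apply/mpolyP=> u; rewrite mcoeff0 -(kos_proj_set0 a u hom_t').
Qed.

Lemma zigzag_cycleS q p t c : zigzag q.+1 p t c -> kos_in (kos_d c).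
Proof.
elim: q p t => [|q IHq] p t /= [t' [_ dt']]; last exact: IHq.
case=> _ /kos_in_d; rewrite kos_dB kos_d_mul -dt' => /kos_inD/(_ (kos_aug_diff t)).
by rewrite subrK.
Qed.

Lemma zigzag_cycle q t c : zigzag q 0 t c -> kos_in (kos_d c).
Proof.
case: q t => [t [<- _]|q t]; last exact: zigzag_cycleS.
by rewrite kos_d_proj0; apply: kos_in0.
Qed.

(** If the end of a zigzag is a boundary modulo I, then walking back along the
    zigzag, using exactness of the resolution at each step, shows that its start
    is zero in homology. *)
Lemma zigzag_reflects_boundary q p t c c' :
    zigzag q p t c -> kos_in (c - kos_d c') ->
  exists (y : V (rank q)) (z : V (rank q.+1)), t = kos_d y + dF q z.
Proof.
elim: q p t => [|q IHq] p t /=.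
  move=> [_ tc] cc'; have [y yc'] := kos_aug_surj c'.
  have [z zP] : exists z : V (rank 1), t - kos_d y = dF 0 z.
    apply/kos_exact0; rewrite kos_mulB -kos_d_mul.
    have := kos_inB (kos_inB cc' tc) (kos_inN (kos_in_d yc')).
    rewrite kos_dB; congr kos_in; apply/ffunP=> A; rewrite !ffunE.
    apply/rowP=> j; rewrite !mxE; ring.
  by exists y, z; rewrite -zP addrC subrK.
case=> t' [_ dt' t'c] cc'; have [y [z def_t']] := IHq _ _ t'c cc'.
have [w wP] : exists w : V _, t - kos_d z = dF q.+1 w.
  apply/kos_exactS; rewrite kos_mulB dt' def_t' kos_dD kos_dd add0r.
  by rewrite kos_d_mul subrr.
by exists z, w; rewrite -wP addrC subrK.
Qed.

(** Every Koszul cycle modulo I is the end of a zigzag.  It is lifted through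
    the resolution one step at a time; the last condition, that the Koszul
    differential of the current chain lifts once more, carries the induction. *)
Lemma zigzag_of_cycle i c : proj0 i c = c -> kos_in (kos_d c) ->
  forall q p, (p + q)%N = i ->
  exists t : V (rank q), [/\ proj q p t = t, zigzag q p t c
    & exists w : V (rank q.+1), kos_d t = dF q w].
Proof.
move=> hom_c dc; elim=> [|q IHq] p def_i.
  rewrite addn0 in def_i; rewrite -{i}def_i in hom_c.
  have [t tc] := kos_aug_surj c.
  exists (proj 0 p t); have c_t : kos_in (c - aug (proj 0 p t)).
    by have := kos_in_proj d g0 p tc; rewrite kos_projB hom_c kos_proj_aug.
  split; [exact: kos_proj_idem | exact: conj hom_c c_t | ].
  apply/kos_exact0; rewrite -kos_d_mul.
  have := kos_inB dc (kos_in_d c_t); rewrite kos_dB.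
  by rewrite opprB addrC subrK.
have [|t [hom_t tc [w dt]]] := IHq p.+1; first by rewrite addSnnS.
have dtw : dF q (proj q.+1 p w) = kos_d t.
  by rewrite -kos_proj_diff -dt -kos_proj_d hom_t.
exists (proj q.+1 p w); split; rewrite ?kos_proj_idem //; first by exists t.
by apply/kos_exactS; rewrite -kos_d_mul dtw kos_dd.
Qed.

(** Conversely, a start that is zero in homology forces the end to be a boundary
    modulo I: exactness of the Koszul complex pushes the two witnesses forward
    along the zigzag. *)
Lemma zigzag_preserves_boundary q p t c y w :
    zigzag q p t c -> proj q p.+1 y = y -> t = kos_d y + dF q w ->
  exists c', kos_in (c - kos_d c').
Proof.
elim: q p t y w => [|q IHq] p t y w /=.
  move=> [_ tc] _ def_t; exists (aug y); move: tc; rewrite def_t kos_mulD.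
  move/kos_inD/(_ (kos_aug_diff w)); rewrite kos_d_mul; congr kos_in.
  by rewrite opprD addrA subrK.
case=> t' [hom_t' dt' t'c] hom_y def_t.
have hom_t'' : proj q p.+1 (t' - dF q y) = t' - dF q y.
  by rewrite kos_projB kos_proj_diff hom_t' hom_y.
have [||y' hom_y' def_y'] := kos_exact hom_t''.
- by rewrite kos_dB -dt' def_t kos_mulD kos_diff_diff addr0 kos_d_mul subrr.
- by move=> j; apply: (kos_proj_set0 _ _ hom_t'').
by apply: (IHq _ _ y' y t'c hom_y'); rewrite -def_y' subrK.
Qed.

End Zigzag.

(** * The squarefree strand *)
Lemma rank_diag_indicator (K : fieldType) N (P : pred 'I_N) :
  \rank (diag_mx (\row_(l < N) (P l)%:R : 'rV[K]_N)) = #|P|.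
Proof.
set E := diag_mx _.
pose M : 'M[K]_(#|P|, N) := \matrix_(i, l) (enum_val i == l)%:R.
have EE i j : E i j = (P i && (i == j))%:R.
  by rewrite !mxE; case: eqP; case: (P i).
have defM : M = \matrix_i row (enum_val i) E.
  apply/matrixP=> i l; rewrite !mxE -mulr_natr.
  by have /= := enum_valP i; rewrite unfold_in => ->; rewrite mul1r.
have eqEM : (E == M)%MS.
  apply/andP; split; apply/row_subP => i; last first.
    by rewrite defM rowK row_sub.
  case: (boolP (P i)) => [Pi|/negPf nPi].
    have -> : row i E = row (enum_rank_in Pi i) M.
      apply/rowP=> j; rewrite !mxE (enum_rankK_in Pi) //.
      by rewrite -mulr_natr Pi mul1r.
    exact: row_sub.
  suff -> : row i E = 0 by apply: sub0mx.
  by apply/rowP=> j; rewrite mxE EE nPi mxE.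
rewrite (eqmx_rank eqEM); apply/eqP; rewrite -[_ == _]/(row_free M).
apply/row_freeP; exists M^T; apply/matrixP=> i j; rewrite !mxE.
rewrite (bigD1 (enum_val i)) //= big1 ?addr0 => [|l li]; last first.
  by rewrite !mxE eq_sym (negPf li) mul0r.
by rewrite !mxE eqxx mul1r (inj_eq enum_val_inj) eq_sym.
Qed.

Section SquarefreeStrand.
Variables (K : fieldType) (X : finType) (Sigma : {set {set X}}).
Local Notation n := #|X|.
Local Notation R := {mpoly K[n]}.
Local Notation mon := 'X_{1..n}.
Local Notation rk := (@enum_rank X).
Local Notation V r := {ffun {set X} -> 'rV[R]_r}.
Local Notation T := ({set X} * {set X})%type.
Local Notation N := #|{: T}|.
Local Notation g0 := (fun _ : 'I_1 => 0 : int).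
Implicit Types (A B : {set X}) (u : mon) (AB : T).

(** The pair (A, B) stands for e_A x_B, where x_B is the squarefree monomial
    of B: for A and B disjoint and B a face, these are the basis elements of
    squarefree multidegree of the Koszul complex of the Stanley-Reisner ring. *)
Definition sqf_pair AB := [disjoint AB.1 & AB.2] && (AB.2 \in Sigma).

Definition sqf_strand (p : nat) (d : int) AB :=
  [&& sqf_pair AB, #|AB.1| == p & (#|AB.1| + #|AB.2|)%N%:Z == d].

Definition sqf_proj p d : 'M[K]_N :=
  diag_mx (\row_l (sqf_strand p d (enum_val l))%:R).

(** Matrices act on row vectors from the right, so that this is the Koszul
    differential of the squarefree part, taking e_A' x_B' to the signed sum of
    the e_A x_B with A' = A + x and B = B' + x. *)
Definition sqf_diff : 'M[K]_N :=
  \matrix_(l', l) let: (AB', AB) := (enum_val l', enum_val l) in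
    if sqf_pair AB then
      \sum_(x in AB.2) (AB' == (x |: AB.1, AB.2 :\ x))%:R * kos_sign K x AB.1
    else 0.

Definition sqf_part (c : V 1) : 'rV[K]_N :=
  \row_l let: AB := enum_val l in
    if sqf_pair AB then kcoef c 0 AB.1 (sqf_mon AB.2) else 0.

Definition sqf_lift (v : 'rV[K]_N) : V 1 :=
  [ffun A => \row__ \sum_(B | sqf_pair (A, B)) v 0 (enum_rank (A, B)) *: 'X_[sqf_mon B]].

Lemma sqf_partP (v v' : 'rV[K]_N) :
  (forall AB, v 0 (enum_rank AB) = v' 0 (enum_rank AB)) -> v = v'.
Proof. by move=> E; apply/rowP=> l; rewrite -[l]enum_valK. Qed.

Lemma sqf_partE c AB :
  sqf_part c 0 (enum_rank AB) =
    if sqf_pair AB then kcoef c 0 AB.1 (sqf_mon AB.2) else 0.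
Proof. by rewrite mxE enum_rankK. Qed.

Lemma sqf_partD c c' : sqf_part (c + c') = sqf_part c + sqf_part c'.
Proof.
apply: sqf_partP => AB; rewrite [RHS]mxE !sqf_partE kcoefD.
by case: ifP; rewrite ?addr0.
Qed.

Lemma sqf_partZ (a : K) c : sqf_part (a%:MP *: c) = a *: sqf_part c.
Proof.
apply: sqf_partP => AB; rewrite [RHS]mxE !sqf_partE kcoefZ.
by case: ifP; rewrite ?mulr0.
Qed.

Lemma sqf_part0 : sqf_part 0 = 0.
Proof.
by have := sqf_partZ 0 0; rewrite mpolyC0 !scale0r.
Qed.

Lemma sqf_partB c c' : sqf_part (c - c') = sqf_part c - sqf_part c'.
Proof.
by rewrite sqf_partD -[- c']scaleN1r -[- _ in RHS]scaleN1r -sqf_partZ mpolyCN mpolyC1.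
Qed.

Lemma sqf_part_in c : kos_in Sigma c -> sqf_part c = 0.
Proof.
move=> c0; apply: sqf_partP => AB; rewrite sqf_partE mxE.
by case: ifP => // /andP[_ BS]; rewrite c0 ?mon_supp_sqf.
Qed.

Lemma mul_sqf_proj p d (v : 'rV[K]_N) AB :
  (v *m sqf_proj p d) 0 (enum_rank AB) =
    if sqf_strand p d AB then v 0 (enum_rank AB) else 0.
Proof.
by rewrite mul_mx_diag !mxE enum_rankK; case: ifP; rewrite ?mulr1 ?mulr0.
Qed.

Lemma mul_sqf_diff (v : 'rV[K]_N) A B :
  (v *m sqf_diff) 0 (enum_rank (A, B)) =
    if sqf_pair (A, B) then
      \sum_(x in B) kos_sign K x A * v 0 (enum_rank (x |: A, B :\ x)) else 0.
Proof.
rewrite mxE; case: ifPn => [AB|/negPf nAB]; last first.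
  by rewrite big1 // => l _; rewrite mxE enum_rankK nAB mulr0.
under eq_bigr do rewrite mxE enum_rankK AB /= mulr_sumr.
rewrite exchange_big; apply: eq_bigr => x xB /=.
rewrite (bigD1 (enum_rank (x |: A, B :\ x))) //= enum_rankK eqxx mul1r mulrC.
rewrite big1 ?addr0 // => l ne_l.
rewrite -(inj_eq enum_rank_inj) enum_valK (negPf ne_l) mul0r mulr0 //.
Qed.

Hypothesis dcS : down_closed Sigma.

Lemma sqf_pair_shift A B x : x \in B -> sqf_pair (A, B) ->
  x \notin A /\ sqf_pair (x |: A, B :\ x).
Proof.
move=> xB /andP[/= dAB BS]; have xA : x \notin A.
  by rewrite disjoint_sym in dAB; rewrite (disjointFr dAB xB).
split=> //; rewrite /sqf_pair /= (dcS (subD1set B x) BS) andbT.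
rewrite disjoints_subset subUset sub1set !inE eqxx -disjoints_subset.
by apply: disjointWr dAB; apply: subD1set.
Qed.

Lemma sqf_mon_sub B x : x \in B -> (sqf_mon B - U_(rk x))%MM = sqf_mon (B :\ x).
Proof.
move=> xB; apply/mnmP=> i; rewrite -[i]enum_valK mnmBE !sqf_monE mnm1E.
rewrite (inj_eq enum_rank_inj) !inE eq_sym.
by case: eqP => [->|]; rewrite ?xB //= subn0.
Qed.

Lemma sqf_part_d c : sqf_part (kos_d c) = sqf_part c *m sqf_diff.
Proof.
apply: sqf_partP => -[A B]; rewrite sqf_partE mul_sqf_diff.
case: ifP => // AB; rewrite kcoef_d /coef_d /= -big_mkcondr /=.
apply: eq_big => [x|x /andP[xA]]; rewrite sqf_monE lt0b.
  by case: (boolP (x \in B)) => xB; rewrite ?andbF ?andbT // (sqf_pair_shift xB AB).1.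
move=> xB; rewrite sqf_partE (sqf_pair_shift xB AB).2.
by rewrite sqf_mon_sub.
Qed.

Lemma sqf_proj_diff p d : sqf_diff *m sqf_proj p d = sqf_proj p.+1 d *m sqf_diff.
Proof.
apply/row_matrixP=> l; rewrite !row_mul.
apply: sqf_partP => -[A B]; rewrite mul_sqf_proj mul_sqf_diff.
rewrite 2![X in if _ then X else _]mxE enum_rankK /= -[l]enum_valK.
move: (enum_val l) => AB'; rewrite enum_rankK.
case: (boolP (sqf_pair (A, B))) => AB; last by rewrite if_same.
transitivity (\sum_(x in B) if sqf_strand p d (A, B) then
   (AB' == (x |: A, B :\ x))%:R * kos_sign K x A else 0).
  by case: ifP => // _; rewrite big1.
apply: eq_bigr => x xB; have [xA AB''] := sqf_pair_shift xB AB.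
rewrite !mxE !enum_rankK (inj_eq enum_rank_inj).
case: (AB' =P _) => [->|_]; last by rewrite mul0r mulr0n mulr0 if_same.
have -> : sqf_strand p.+1 d (x |: A, B :\ x) = sqf_strand p d (A, B).
  rewrite /sqf_strand AB AB'' /= cardsU1 xA eqSS [#|B|](cardsD1 x) xB.
  by congr (_ && (_ == _)); lia.
by case: ifP; rewrite ?mul1r ?mulr1 ?mulr0 ?mul0rn.
Qed.

Lemma kcoef_sqf_lift v A u :
  kcoef (sqf_lift v) 0 A u =
    if (u == sqf_mon (mon_supp u)) && sqf_pair (A, mon_supp u)
    then v 0 (enum_rank (A, mon_supp u)) else 0.
Proof.
rewrite /kcoef ffunE mxE raddf_sum /=.
under eq_bigr do rewrite mcoeffZ mcoeffX.
case: ifP => [/andP[/eqP def_u Au]|nAu].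
  rewrite (bigD1 (mon_supp u)) //= -def_u eqxx mulr1 big1 ?addr0 // => B /andP[_ Bu].
  by case: eqP => [def_B|]; rewrite ?mulr0 //; case/eqP: Bu; rewrite -def_B mon_supp_sqf.
rewrite big1 // => B AB; case: eqP => [def_B|]; rewrite ?mulr0 //.
by move: nAu; rewrite -def_B mon_supp_sqf eqxx AB.
Qed.

Lemma sqf_lift_proj p d v : v *m sqf_proj p d = v ->
  kos_proj d g0 p (sqf_lift v) = sqf_lift v.
Proof.
move=> hom_v; apply: kcoefP => j A u; rewrite ord1 kcoef_proj kcoef_sqf_lift.
case: (boolP ((u == _) && _)) => [/andP[/eqP def_u Au]|_]; last by rewrite if_same.
rewrite -hom_v mul_sqf_proj /sqf_strand Au /= addr0.
by rewrite {1}def_u mdeg_sqf; case: (_ && _).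
Qed.

Lemma sqf_liftK p d v : v *m sqf_proj p d = v -> sqf_part (sqf_lift v) = v.
Proof.
move=> hom_v; apply: sqf_partP => -[A B].
rewrite sqf_partE kcoef_sqf_lift mon_supp_sqf eqxx /=.
case: (boolP (sqf_pair (A, B))) => //= /negPf nAB.
by rewrite -hom_v mul_sqf_proj /sqf_strand nAB.
Qed.

(** The differential of a chain supported in squarefree multidegrees is again so
    supported; hence its coefficients on monomials outside I are exactly those
    computed by the matrix of the squarefree strand. *)
Lemma sqf_lift_cycle p d v : v *m sqf_proj p d = v -> v *m sqf_diff = 0 ->
  kos_in Sigma (kos_d (sqf_lift v)).
Proof.
move=> hom_v dv A u uS.
case: (boolP ((u == sqf_mon (mon_supp u)) && sqf_pair (A, mon_supp u))).
  case/andP=> /eqP def_u Au.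
  have := sqf_part_d (sqf_lift v); rewrite (sqf_liftK hom_v) dv.
  move/rowP/(_ (enum_rank (A, mon_supp u))).
  by rewrite sqf_partE Au mxE /= -def_u.
rewrite /sqf_pair uS andbT /= => nAu.
rewrite kcoef_d /coef_d big1 // => x xA; case: ifP => // ux.
rewrite kcoef_sqf_lift; case: ifP; rewrite ?mulr0 //.
set w := (u - U_(rk x))%MM => /andP[/eqP def_w /andP[/= dw _]].
case/negP: nAu; have def_u : u = (w + U_(rk x))%MM.
  by rewrite /w submK // lep1mP -lt0n.
have xw : x \notin mon_supp w by rewrite (disjointFr dw) // setU11.
have wx : w (rk x) = 0%N by move: xw; rewrite inE; lia.
have supp_u : mon_supp u = x |: mon_supp w.
  apply/setP=> y; rewrite !inE def_u mnmDE mnm1E (inj_eq enum_rank_inj) eq_sym.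
  by case: eqP => /= [->|_]; rewrite ?addn1 ?addn0.
apply/andP; split; last first.
  rewrite supp_u disjoint_sym disjoints_subset subUset sub1set !inE xA.
  rewrite -disjoints_subset disjoint_sym.
  by apply: disjointWl dw; apply: subsetUr.
apply/eqP/mnmP=> i; rewrite -[i]enum_valK sqf_monE supp_u def_u mnmDE mnm1E.
rewrite (inj_eq enum_rank_inj) !inE; case: eqP => /= [<-|/eqP ne].
  by rewrite wx eqxx.
by rewrite eq_sym (negPf ne) addn0 {1}def_w sqf_monE inE.
Qed.

(** The strands of non-squarefree multidegree are exact.  There the homotopy
    with threshold 2 picks a vertex x of exponent at least 2, so multiplying or
    dividing by x does not change supports, and the homotopy preserves the
    chains with coefficients in I. *)
Lemma sqf_part0_boundary c : kos_in Sigma (kos_d c) -> sqf_part c = 0 ->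
  exists c', kos_in Sigma (c - kos_d c').
Proof.
move=> dc c0; exists (kos_s 2 c) => A u uS; rewrite kcoefD kcoefN.
have := kos_homotopy c 0 A u (ltn0Sn 1).
rewrite kcoefD [X in _ + X](_ : _ = 0) ?addr0 => [->|]; last first.
  rewrite kcoef_s /coef_s /deg_pick; case: pickP => // x ux; case: ifP => // xA.
  rewrite dc ?mulr0 //.
  suff -> : mon_supp (u + U_(rk x)) = mon_supp u by [].
  apply/setP=> y.
  rewrite !inE mnmDE mnm1E (inj_eq enum_rank_inj); case: eqP => [<-|]; last first.
    by rewrite addn0.
  by move: ux; rewrite /multidegree xA; lia.
rewrite /deg_pick; case: pickP => [x _|no_x]; rewrite ?subrr ?subr0 //.
have u_sqf : u = sqf_mon (mon_supp u).
  apply/mnmP=> i; rewrite -[i]enum_valK sqf_monE inE.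
  have := no_x (enum_val i); rewrite /multidegree.
  by case: (u _) => [|[|m]] //; rewrite addnC.
move/rowP/(_ (enum_rank (A, mon_supp u))): c0.
rewrite sqf_partE mxE /= -u_sqf /sqf_pair /= uS andbT.
case: ifPn => // /pred0Pn[x /andP[/= xA]]; rewrite inE => ux.
by have := no_x x; rewrite /multidegree xA; lia.
Qed.

End SquarefreeStrand.

(** * Betti numbers as ranks *)
Section BettiRank.
Variables (K : fieldType) (X : finType) (Sigma : {set {set X}}).
Hypothesis dcS : down_closed Sigma.
Variable F : min_graded_free_res (@SR_ideal X K Sigma).
Variables (i : nat) (d : int).
Local Notation n := #|X|.
Local Notation R := {mpoly K[n]}.
Local Notation V r := {ffun {set X} -> 'rV[R]_r}.
Local Notation g0 := (fun _ : 'I_1 => 0 : int).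
Local Notation rank := (mfr_rank F).
Local Notation dF q := (kos_mul (mfr_diff F q)).
Local Notation proj q := (kos_proj d (mfr_deg (m := F) (i := q))).
Local Notation zigzag := (zigzag d).
Local Notation beta := (betti F i d).
Local Notation E p := (sqf_proj K Sigma p d).
Local Notation D := (sqf_diff K Sigma).

Definition gen_index (l : 'I_beta) : 'I_(rank i) := enum_val l.

Lemma deg_gen l : mfr_deg (gen_index l) = d.
Proof. by have := enum_valP l; rewrite inE => /eqP. Qed.

Definition kos_gen (l : 'I_beta) : V (rank i) :=
  [ffun A => if A == set0 then delta_mx 0 (gen_index l) else 0].

Lemma kcoef_gen l j A u :
  kcoef (kos_gen l) j A u = [&& A == set0, u == 0%MM & j == gen_index l]%:R.
Proof.
rewrite /kcoef ffunE; case: eqP => _ /=; last by rewrite mxE mcoeff0.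
rewrite mxE eqxx /=; case: eqP => _; last by rewrite andbF mcoeff0.
by rewrite andbT mcoeff1.
Qed.

Lemma kos_gen_hom l : proj i 0 (kos_gen l) = kos_gen l.
Proof.
apply: kcoefP => j A u; rewrite kcoef_proj kcoef_gen.
case: (boolP [&& _, _ & _]) => [/and3P[/eqP-> /eqP-> /eqP->]|_].
  by rewrite cards0 mdeg0 deg_gen addn0 add0r !eqxx.
by case: ifP.
Qed.

Lemma kos_gen_start l : zigzag_start (kos_gen l).
Proof.
have := kos_gen_hom l; move: (kos_gen l).
have min := @mfr_minimal _ _ _ F.
case: (i) => //= q t hom_t; split.
  by rewrite kos_d_mul -hom_t kos_d_proj0 kos_mul0.
move=> j; rewrite /kcoef ffunE mxE raddf_sum big1 //= => a _.
by rewrite rmorphM /= min mulr0.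
Qed.

(** The Koszul differential multiplies by variables, and the differential of a
    minimal resolution has no constant coefficients. *)
Lemma kcoef_boundary0 (y : V (rank i)) (z : V (rank i.+1)) j :
  kcoef (kos_d y + dF i z) j set0 0%MM = 0.
Proof.
rewrite kcoefD kcoef_d /coef_d big1 ?add0r => [|x _]; last by rewrite mnm0E.
rewrite /kcoef ffunE mxE raddf_sum big1 //= => a _.
by rewrite rmorphM /= mfr_minimal mulr0.
Qed.

Lemma kcoef_sum r (I : Type) (s : seq I) (t : I -> V r) j A u :
  kcoef (\sum_(l <- s) t l) j A u = \sum_(l <- s) kcoef (t l) j A u.
Proof.
elim: s => [|l s IHs]; first by rewrite !big_nil /kcoef ffunE mxE mcoeff0.
by rewrite !big_cons kcoefD IHs.
Qed.

Lemma kcoef_gen_sum (v : 'rV[K]_beta) l :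
  kcoef (\sum_l (v 0 l)%:MP *: kos_gen l) (gen_index l) set0 0%MM = v 0 l.
Proof.
rewrite kcoef_sum (bigD1 l) //= big1 ?addr0 => [|l' ne_l].
  by rewrite kcoefZ kcoef_gen !eqxx mulr1.
rewrite kcoefZ kcoef_gen !eqxx /= (inj_eq enum_val_inj) eq_sym (negPf ne_l).
by rewrite mulr0.
Qed.

(** The Betti number beta_(i, d) is the dimension of the i-th homology of the
    squarefree strand of degree d, written as a rank count.  Each generator of
    degree d of F_i starts a zigzag, which ends in a Koszul cycle.  The
    squarefree parts of these cycles, the rows of Phi, form a basis of the
    cycles of the squarefree strand modulo its boundaries. *)
Lemma betti_rank :
  (betti F i d + \rank (E i *m D) + \rank (E i.+1 *m D))%N
    = #|[pred AB | sqf_strand Sigma i d AB]|.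
Proof.
have /fin_all_exists[c cP] l : exists c : V 1, zigzag 0 (kos_gen l) c.
  by apply: zigzag_exists; [exact: kos_gen_hom | exact: kos_gen_start].
pose Phi := \matrix_l sqf_part Sigma (c l).
pose comb (v : 'rV[K]_beta) : V 1 := \sum_l (v 0 l)%:MP *: c l.
have zigzag_comb (v : 'rV[K]_beta) : zigzag 0 (\sum_l (v 0 l)%:MP *: kos_gen l) (comb v).
  exact: zigzag_sum.
have part_comb (v : 'rV[K]_beta) : sqf_part Sigma (comb v) = v *m Phi.
  rewrite mulmx_sum_row /comb.
  elim/big_rec2: _ => [|l x y _ <-]; first exact: sqf_part0.
  by rewrite sqf_partD sqf_partZ rowK.
have hom_part (x : V 1) p : kos_proj d g0 p x = x ->
    sqf_part Sigma x *m E p = sqf_part Sigma x.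
  move=> hom_x; apply: sqf_partP => AB; rewrite mul_sqf_proj.
  case: ifPn => // nAB; rewrite sqf_partE; case: ifPn => // AB_pair.
  rewrite -hom_x kcoef_proj addr0 mdeg_sqf; case: ifP => // AB_p.
  by case/negP: nAB; rewrite /sqf_strand AB_pair.
have EE p : E p *m E p = E p.
  apply/row_matrixP=> l; rewrite row_mul; apply: sqf_partP => AB.
  rewrite mul_sqf_proj !mxE; case: eqP => [->|_]; rewrite ?enum_rankK ?mulr0n.
    by case: (sqf_strand _ _ _ _).
  by rewrite if_same.
have DD (v : 'rV_ _) p : v *m E p = v -> v *m D *m D = 0.
  move=> hom_v; rewrite -(sqf_liftK hom_v) -!(sqf_part_d dcS) kos_dd.
  exact: sqf_part0.
(* The rows of Phi are independent modulo boundaries: a combination that bounds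
   starts from a combination of generators in the maximal ideal times F_i. *)
have indep (v : 'rV[K]_beta) w : v *m Phi = w *m (E i.+1 *m D) -> v = 0.
  move=> vw; pose b := sqf_lift Sigma (w *m E i.+1).
  have hom_w : w *m E i.+1 *m E i.+1 = w *m E i.+1 by rewrite -mulmxA EE.
  have [||c' cc'] := sqf_part0_boundary (Sigma := Sigma) (c := comb v - kos_d b).
  - rewrite kos_dB kos_dd subr0; exact: zigzag_cycle (zigzag_comb v).
  - by rewrite sqf_partB part_comb sqf_part_d // (sqf_liftK hom_w) vw mulmxA subrr.
  have [|y [z def_v]] := zigzag_reflects_boundary dcS (zigzag_comb v) (c' := b + c').
    by rewrite kos_dD opprD addrA.
  apply/rowP=> l; rewrite mxE -kcoef_gen_sum def_v; exact: kcoef_boundary0.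
have eqZ : (E i :&: kermx D == Phi + E i.+1 *m D)%MS.
  apply/andP; split.
    apply/rV_subP => v; rewrite sub_capmx => /andP[/submxP[v' def_v] /sub_kermxP Dv].
    have hom_v : v *m E i = v by rewrite def_v -mulmxA EE.
    have hom_c := sqf_lift_proj hom_v.
    have [t [hom_t tc _]] := zigzag_of_cycle dcS F hom_c
      (sqf_lift_cycle dcS hom_v Dv) (add0n i).
    (* The constant coefficients of the start of a zigzag to v prescribe the
       combination of generators to subtract. *)
    pose a : 'rV[K]_beta := \row_l kcoef t (gen_index l) set0 0%MM.
    pose ta := \sum_l (a 0 l)%:MP *: kos_gen l.
    have hom_ta : proj i 0 ta = ta.
      rewrite /ta; elim/big_rec: _ => [|l x _ hom_x]; first exact: kos_proj0.
      by rewrite kos_projD kos_projZ kos_gen_hom hom_x.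
    have hom_tt : proj i 0 (t - ta) = t - ta by rewrite kos_projB hom_t hom_ta.
    have [|j|y hom_y def_y] := kos_exact hom_tt.
    - by rewrite -hom_tt kos_d_proj0.
    - case: (boolP (mfr_deg j == d)) => [deg_j|/negPf ndeg_j].
        have jJ : j \in [set a | mfr_deg a == d] by rewrite inE.
        have [l ->] : exists l, j = gen_index l.
          by exists (enum_rank_in jJ j); rewrite /gen_index enum_rankK_in.
        by rewrite kcoefD kcoefN kcoef_gen_sum mxE subrr.
      by rewrite -hom_tt kcoef_proj cards0 mdeg0 addn0 add0r ndeg_j andbF.
    have [|c' cc'] := zigzag_preserves_boundary dcS (zigzagB tc (zigzag_comb a)) hom_y (w := 0).
      by rewrite kos_mul0 addr0.
    have def_va : v - a *m Phi = sqf_part Sigma c' *m D.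
      have := sqf_part_in cc'; rewrite !sqf_partB part_comb sqf_part_d //.
      by rewrite (sqf_liftK hom_v) => /eqP; rewrite subr_eq0 => /eqP.
    have hom_a : a *m Phi *m E i = a *m Phi.
      rewrite -part_comb; apply: hom_part; exact: zigzag_hom (zigzag_comb a).
    apply/sub_addsmxP; exists (a, sqf_part Sigma c') => /=.
    rewrite -sqf_proj_diff // mulmxA -def_va mulmxBl hom_v hom_a.
    by rewrite addrC subrK.
  rewrite addsmx_sub !sub_capmx; apply/andP; split; apply/andP; split.
  - apply/row_subP=> l; rewrite rowK -(hom_part _ i) ?submxMl //.
    exact: zigzag_hom (cP l).
  - apply/sub_kermxP/row_matrixP=> l; rewrite row_mul rowK row0 -sqf_part_d //.
    exact/sqf_part_in/(zigzag_cycle dcS (cP l)).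
  - by rewrite -sqf_proj_diff // submxMl.
  apply/sub_kermxP/row_matrixP=> l; rewrite row0 !row_mul.
  by apply: (DD _ i.+1); rewrite -row_mul EE.
have rPhi : \rank Phi = beta.
  apply/eqP/inj_row_free => v vPhi; apply: (indep v 0).
  by rewrite vPhi mul0mx.
have disj : (Phi :&: (E i.+1 *m D))%MS = 0.
  apply/eqP/rowV0P=> v; rewrite sub_capmx => /andP[/submxP[a ->] /submxP[w aw]].
  by rewrite (indep _ _ aw) mul0mx.
have := mxrank_mul_ker (E i) D; rewrite (eqmx_rank eqZ).
rewrite (mxrank_disjoint_sum disj) rPhi rank_diag_indicator => eq_rank.
transitivity #|fun l : 'I_#|{: {set X} * {set X}}| => sqf_strand Sigma i d (enum_val l)|.
  by rewrite -eq_rank; lia.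
rewrite -[RHS]sum1_card (reindex (@enum_val {: {set X} * {set X}} predT)) /=.
  by rewrite sum1_card.
exact/onW_bij/enum_val_bij.
Qed.

End BettiRank.

(** * Skeleta, Euler characteristics and binomial sums *)
Section Skeleton.
Variables (K : fieldType) (X : finType) (Gamma Sigma : {set {set X}}) (s : nat).
Hypothesis dcG : down_closed Gamma.
Hypothesis SigmaE : forall B, (B \in Sigma) = (B \in Gamma) && (#|B| <= s)%N.

Lemma down_closed_skeleton : down_closed Sigma.
Proof.
move=> A B sAB; rewrite !SigmaE => /andP[BG Bs]; rewrite (dcG sAB BG) /=.
exact: leq_trans (subset_leq_card sAB) Bs.
Qed.

Lemma sqf_strand_skeleton p (d : int) AB : d - p%:Z <= s%:Z ->
  sqf_strand Sigma p d AB = sqf_strand Gamma p d AB.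
Proof.
move=> le_ds; rewrite /sqf_strand; apply: andb_id2r => /andP[/eqP Ap /eqP ABd].
rewrite /sqf_pair SigmaE (_ : (#|AB.2| <= s)%N) ?andbT //; lia.
Qed.

Lemma sqf_strand_above p (d : int) AB :
  s%:Z < d - p%:Z -> sqf_strand Sigma p d AB = false.
Proof.
move=> lt_sd; apply/negP => /and3P[/andP[_]]; rewrite SigmaE => /andP[_ le_s].
by move=> /eqP Ap /eqP ABd; lia.
Qed.

(** The differential from exterior degree p to p - 1 only involves faces of
    cardinality d - p and d - p + 1. *)
Lemma sqf_rank_skeleton p (d : int) : d - p%:Z < s%:Z ->
  sqf_proj K Sigma p d *m sqf_diff K Sigma = sqf_proj K Gamma p d *m sqf_diff K Gamma.
Proof.
move=> lt_ds; apply/matrixP=> l' l; rewrite !mul_diag_mx !mxE.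
rewrite sqf_strand_skeleton ?ltW //.
case: (boolP (sqf_strand _ _ _ _)) => [/and3P[_ /eqP Ap /eqP ABd]|_]; last by rewrite !mul0r.
congr (_ * _); rewrite /sqf_pair SigmaE andbA.
case: (leqP #|(enum_val l).2| s) => [_|lt_sB]; first by rewrite andbT.
rewrite andbF; case: ifP => // _; rewrite big1 // => x xB.
case: eqP => [def_l'|_]; last by rewrite mul0r.
exfalso; move: ABd; rewrite def_l' /= in Ap *; move: lt_sB.
rewrite (cardsD1 x) xB add1n ltnS; move: lt_ds Ap.
by move: #|_ :\ _| #|_ |: _| => a b; lia.
Qed.

End Skeleton.

Lemma bin_trinomial n q v : ('C(n, q + v) * 'C(q + v, v) = 'C(n, q) * 'C(n - q, v))%N.
Proof.
case: (leqP (q + v) n) => [le_n|lt_n]; last first.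
  rewrite (bin_small lt_n) mul0n; case: (ltnP n q) => [lt_nq|le_qn].
    by rewrite (bin_small lt_nq).
  by rewrite [X in (_ * X)%N]bin_small ?muln0 //; lia.
have f1 := bin_fact le_n; have f2 := bin_fact (leq_addl q v).
have le_q : (q <= n)%N by lia.
have le_v : (v <= n - q)%N by lia.
have f3 := bin_fact le_q; have f4 := bin_fact le_v.
rewrite addnK in f2; rewrite subnDA in f1.
apply/eqP; rewrite -(eqn_pmul2r (fact_gt0 v)) -(eqn_pmul2r (fact_gt0 q)).
rewrite -(eqn_pmul2r (fact_gt0 (n - q - v))); apply/eqP.
transitivity (n`!); first by rewrite -f1 -f2; ring.
by rewrite -f3 -f4; ring.
Qed.

Lemma alternating_bin_sum a i M :
  \sum_(u < M) (-1) ^+ u * ('C(a.+1, i.+1 + u))%:Z =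
    'C(a, i)%:Z - (-1) ^+ M * 'C(a, i + M)%:Z.
Proof.
elim: M => [|M IHM]; first by rewrite big_ord0 addn0 expr0 mul1r subrr.
rewrite big_ord_recr /= IHM addSn binS PoszD exprS addnS; ring.
Qed.

(** The alternating sum counts, with signs, the pairs (A, B) of the squarefree
    strands such that the complement of B lies in a given set of n of the N
    vertices: by trinomial revision it is one binomial coefficient times a truncated alternating row sum of Pascal's triangle.  The
    convention that binomials of negative integers vanish covers the cases
    i + s > N and n <= N - i - s. *)
Lemma simplex_contribution n N s i : (n <= N)%N -> (s <= N)%N -> (0 < i)%N ->
  \sum_(u < s.+1) (-1) ^+ u * ('C(n, N - (s - u)) * 'C(N - (s - u), i + u))%N%:Z =
    (binomz n (N%:Z - (i + s)%N%:Z))%:Z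
    * (binomz (n%:Z - N%:Z + (i + s)%N%:Z - 1) (i%:Z - 1))%:Z.
Proof.
move=> le_nN le_sN; case: i => // i _.
have NE (u : 'I_s.+1) : (N - (s - u) = N - s + u)%N by have := ltn_ord u; lia.
case: (ltnP N (i.+1 + s)) => [lt_N|le_N].
  rewrite big1 => [|u _]; last by rewrite NE [X in (_ * X)%N]bin_small ?muln0 ?mulr0 //; lia.
  have -> : N%:Z - (i.+1 + s)%N%:Z = Negz ((i.+1 + s) - N).-1 by lia.
  by rewrite mul0r.
set q := (N - (i.+1 + s))%N.
have -> : N%:Z - (i.+1 + s)%N%:Z = q%:Z by lia.
have -> : i.+1%:Z - 1 = i%:Z by lia.
under eq_bigr => u _.
  rewrite NE (_ : N - s + u = q + (i.+1 + u))%N; last by lia.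
  rewrite bin_trinomial PoszM mulrCA.
  over.
rewrite -mulr_sumr; congr (_ * _).
case def_a: (n - q)%N => [|a].
  case: (leqP n q) => [le_nq|]; last by lia.
  rewrite big1 => [|u _]; last by rewrite bin_small ?mulr0 //; lia.
  have -> : n%:Z - N%:Z + (i.+1 + s)%N%:Z - 1 = Negz (q - n) by lia.
  by [].
rewrite alternating_bin_sum (_ : n%:Z - N%:Z + _ - 1 = a%:Z); last by lia.
by rewrite [X in _ - _ * X%:Z]bin_small ?mulr0 ?subr0 //; lia.
Qed.

Section EulerCharacteristic.
Variables (K : fieldType) (X : finType) (Sigma : {set {set X}}).

Lemma sqf_rank0 d : \rank (sqf_proj K Sigma 0 d *m sqf_diff K Sigma) = 0%N.
Proof.
apply/eqP; rewrite mxrank_eq0; apply/eqP/matrixP=> l l'; rewrite mul_diag_mx !mxE.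
case: (boolP (sqf_strand _ _ _ _)) => [/and3P[_ /eqP A0 _]|_]; last by rewrite mul0r.
rewrite mul1r; case: ifP => // _; apply: big1 => x _.
case: eqP => [def_l|_]; last by rewrite mul0r.
have : x \in (enum_val l).1 by rewrite def_l setU11.
by rewrite (cards0_eq A0) inE.
Qed.

Lemma sqf_rank_above p (d : nat) : (d < p)%N ->
  \rank (sqf_proj K Sigma p d *m sqf_diff K Sigma) = 0%N.
Proof.
move=> lt_dp; apply/eqP; rewrite mxrank_eq0; apply/eqP/matrixP=> l l'.
rewrite mul_diag_mx !mxE; case: (boolP (sqf_strand _ _ _ _)); rewrite ?mul0r //.
by case/and3P=> _ /eqP Ap /eqP; lia.
Qed.

Hypothesis dcS : down_closed Sigma.
Variable F : min_graded_free_res (@SR_ideal X K Sigma).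

(** The ranks telescope when the homology of the squarefree strand is
    traded for the strand itself. *)
Lemma betti_euler (d : nat) :
  \sum_(p < d.+1) (-1) ^+ p * (betti F p d)%:Z =
  \sum_(p < d.+1) (-1) ^+ p * #|[pred AB | sqf_strand Sigma p d AB]|%:Z.
Proof.
pose rho p : int := (\rank (sqf_proj K Sigma p d *m sqf_diff K Sigma))%:Z.
suff: forall M, \sum_(p < M) (-1) ^+ p * #|[pred AB | sqf_strand Sigma p d AB]|%:Z =
    \sum_(p < M) (-1) ^+ p * (betti F p d)%:Z - (-1) ^+ M * rho M.
  by move=> ->; rewrite /rho sqf_rank_above // mulr0 subr0.
elim=> [|M IHM]; first by rewrite !big_ord0 /rho sqf_rank0 mulr0 subr0.
rewrite !big_ord_recr /= IHM -(betti_rank dcS F M d) !PoszD -!/(rho _) exprS; ring.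
Qed.

Lemma card_sqf_strand p q :
  #|[pred AB | sqf_strand Sigma p (p + q)%N AB]| =
    (#|[set B in Sigma | #|B| == q]| * 'C(#|X| - q, p))%N.
Proof.
transitivity (\sum_(AB | sqf_strand Sigma p (p + q)%N AB) 1)%N.
  by rewrite sum1_card.
rewrite (partition_big snd (mem [set B in Sigma | #|B| == q])) /=; last first.
  move=> [A B] /and3P[/andP[_ /= BS] /eqP Ap /eqP].
  by rewrite inE BS /= => ABd; apply/eqP; lia.
rewrite -sum_nat_const; apply: eq_bigr => B; rewrite inE => /andP[BS /eqP Bq].
have <- : #|~: B| = (#|X| - q)%N by have := cardsC B; lia.
rewrite -cards_draws -(card_imset _ (f := fun A => (A, B))) => [|A A' [] //].
rewrite sum1_card; apply: eq_card => -[A B']; rewrite unfold_in /=.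
apply/andP/imsetP => [[/and3P[/andP[/= dAB _] Ap _] /eqP <-]|[A' + [-> ->]]].
  by exists A => //; rewrite inE -disjoints_subset dAB.
rewrite inE -disjoints_subset eqxx => /andP[dAB /eqP Ap]; split=> //.
by rewrite /sqf_strand /sqf_pair /= dAB BS Ap Bq !eqxx.
Qed.

End EulerCharacteristic.

(** * Counting faces along a leaf order *)
Section FaceCount.
Variables (X : finType) (S : seq {set X}).
Hypothesis leafP : forall m, (0 < m < size S)%N ->
  exists2 p, (p < m)%N & forall i, (i < m)%N ->
    nth set0 S m :&: nth set0 S i \subset nth set0 S m :&: nth set0 S p.

Lemma separator_parent m : (m.+1 < size S)%N ->
  exists2 p, (p < m.+1)%N & separator S m = nth set0 S m.+1 :&: nth set0 S p.
Proof.
move=> lt_m; have [|p lt_p pP] := leafP (m := m.+1); first by [].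
exists p => //; apply/eqP; rewrite eqEsubset; apply/andP; split.
  apply/subsetP=> x; rewrite inE => /andP[/bigcupP[i _ xi] xm].
  by have /subsetP/(_ x) := pP i (ltn_ord i); rewrite inE xi xm; apply.
rewrite /separator setIC; apply: setSI.
exact: (bigcup_sup (Ordinal lt_p)).
Qed.

Lemma separatorP m (C : {set X}) : (m.+1 < size S)%N ->
  (C \subset separator S m) =
    (C \subset nth set0 S m.+1) && [exists i : 'I_m.+1, C \subset nth set0 S i].
Proof.
move=> lt_m; apply/idP/andP => [sCQ|[sCm /existsP[i sCi]]].
  have [p lt_p def_Q] := separator_parent lt_m.
  rewrite def_Q subsetI in sCQ; case/andP: sCQ => -> sCp; split=> //.
  by apply/existsP; exists (Ordinal lt_p).
rewrite subsetI sCm andbT; apply: subset_trans sCi _.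
exact: (bigcup_sup i).
Qed.

(** Adding the facet S_(m+1) adds its subsets, except those already counted,
    which are the subsets of the separator. *)
Lemma card_faces t e : (0 < e <= size S)%N ->
  (#|[set C : {set X} | [exists i : 'I_e, C \subset nth set0 S i] & #|C| == t]|
     + \sum_(m < e.-1) 'C(#|separator S m|, t)
   = \sum_(m < e) 'C(#|nth set0 S m|, t))%N.
Proof.
case: e => // e /=; elim: e => [|e IHe] lt_e.
  rewrite big_ord0 big_ord1 addn0 -cards_draws; apply: eq_card => C; rewrite !inE.
  by congr (_ && _); apply/existsP/idP => [[i]|]; [rewrite ord1 | exists ord0].
rewrite big_ord_recr /= [RHS]big_ord_recr /= -IHe ?(ltnW lt_e) //.
set U := [set C : {set X} | [exists i : 'I_e.+1, C \subset nth set0 S i] & #|C| == t].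
set U' := [set C | _ & _]; set W := [set C : {set X} | C \subset nth set0 S e.+1 & #|C| == t].
have -> : U' = U :|: W.
  apply/setP=> C; rewrite !inE -andb_orl; congr (_ && _); apply/existsP/orP.
    case=> i sCi; case: (ltnP i e.+1) => [lt_i|le_i].
      by left; apply/existsP; exists (Ordinal lt_i).
    by right; have <- : nat_of_ord i = e.+1 by have := ltn_ord i; lia.
  case=> [/existsP[i sCi]|sC]; last by exists ord_max.
  by exists (widen_ord (leqnSn _) i).
have cW : #|W| = 'C(#|nth set0 S e.+1|, t) by rewrite cards_draws.
have cUW : #|U :&: W| = 'C(#|separator S e|, t).
  rewrite -cards_draws; apply: eq_card => C; rewrite !inE separatorP //.
  by case: (C \subset _); rewrite ?andbF //= ?andbT; case: (#|C| == t); rewrite ?andbT ?andbF.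
rewrite -cW -cUW; by rewrite addnCA cardsUI addnCA addnA.
Qed.

End FaceCount.

(** * The Hilbert-Burch resolution of the Alexander dual *)
Section DualResolution.
Variables (K : fieldType) (X : finType) (S : seq {set X}) (Gamma : {set {set X}}).
Local Notation n := #|X|.
Local Notation R := {mpoly K[n]}.
Local Notation e := (size S).
Local Notation F a := (nth set0 S a).
Local Notation Q m := (separator S m).
Local Notation M A := ('X_[sqf_mon A] : R).
Implicit Types (A B : {set X}) (u : 'X_{1..n}).

Hypothesis dcG : down_closed Gamma.
Hypothesis GammaN : forall B,
  (B \notin Gamma) = [exists a : 'I_e, ~: F a \subset B].
Hypothesis antichain : forall a b : 'I_e, F a \subset F b -> a = b.
Hypothesis e_gt1 : (1 < e)%N.
Variable p : 'I_e.-1 -> 'I_e.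
Hypothesis p_lt : forall m, (p m < m.+1)%N.
Hypothesis sepE : forall m : 'I_e.-1, Q m = F m.+1 :&: F (p m).
Hypothesis sepP : forall (m : 'I_e.-1) i, (i < m.+1)%N -> F m.+1 :&: F i \subset Q m.

Lemma mon_neq0 A : M A != 0.
Proof.
apply/eqP => /(congr1 (mcoeff (sqf_mon A))); rewrite mcoeffX eqxx mcoeff0.
by move/eqP; rewrite oner_eq0.
Qed.

Lemma mon_mul_disjoint A B : [disjoint A & B] -> M A * M B = M (A :|: B).
Proof.
move=> dAB; rewrite -mpolyXD; congr mpolyX; apply/mnmP => i.
rewrite -[i]enum_valK mnmDE !sqf_monE inE.
case: (boolP (_ \in A)) => // xA; by rewrite (disjointFr dAB xA).
Qed.

Definition dual_gens : 'M[R]_(e, 1) := \col_a M (~: F a).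

(** One syzygy per separator: it relates the generators of the facet S_(m+1)
    and of its parent in the leaf order, both of which contain Q_m. *)
Definition dual_syz : 'M[R]_(e.-1, e) :=
  \matrix_(m, b) (((b == m.+1 :> nat)%:R - (b == p m)%:R) * M (F b :\: Q m)).

Lemma ltn_succ (m : 'I_e.-1) : (m.+1 < e)%N.
Proof. by case: m => m /= ltm; lia. Qed.

Definition osucc (m : 'I_e.-1) : 'I_e := Ordinal (ltn_succ m).

Lemma sep_sub_succ (m : 'I_e.-1) : Q m \subset F (osucc m).
Proof. by rewrite sepE subsetIl. Qed.

Lemma sep_sub_parent (m : 'I_e.-1) : Q m \subset F (p m).
Proof. by rewrite sepE subsetIr. Qed.

Lemma parent_neq m : p m != osucc m.
Proof. by rewrite -val_eqE /= neq_ltn p_lt. Qed.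

Lemma dual_syzE m b : dual_syz m b =
  if b == osucc m then M (F (osucc m) :\: Q m)
  else if b == p m then - M (F (p m) :\: Q m) else 0.
Proof.
rewrite mxE -[(b : nat) == _]/(b == osucc m).
case: eqP => [->|_]; first by rewrite eq_sym (negPf (parent_neq m)) subr0 mul1r.
by case: eqP => [->|_]; rewrite sub0r ?mulN1r // oppr0 mul0r.
Qed.

Lemma mon_complement A B : A \subset B -> M (B :\: A) * M (~: B) = M (~: A).
Proof.
move=> sAB; rewrite mon_mul_disjoint; last first.
  by rewrite disjoints_subset setCK subsetDl.
congr mpolyX; congr sqf_mon; apply/setP=> x; rewrite !inE.
by have /subsetP/(_ x) := sAB; case: (x \in A) => [->|] //; case: (x \in B).
Qed.

Lemma dual_syz_gens : dual_syz *m dual_gens = 0.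
Proof.
apply/matrixP=> m j; rewrite !mxE (bigD1 (osucc m)) //= (bigD1 (p m)) ?parent_neq //=.
rewrite !dual_syzE eqxx (negPf (parent_neq m)) eqxx !mxE mulNr.
rewrite !mon_complement ?sep_sub_succ ?sep_sub_parent // big1 ?addr0 ?subrr //.
by move=> b /andP[/negPf nb /negPf nb']; rewrite dual_syzE nb nb' mul0r.
Qed.

Lemma mon_dvd (f : R) A : (forall u, f@_u != 0 -> A \subset mon_supp u) ->
  exists q, f = q * M A.
Proof.
move=> fA; have [|c ->] := @sqf_ideal_memP K X _ predT (fun _ : 'I_1 => A) f.
  by move=> u /fA; exists ord0.
by exists (c ord0); rewrite big_ord1.
Qed.

(** A syzygy involving only the first t + 1 generators has its last coefficient
    divisible by the last coefficient of the syzygy attached to the facet of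
    index t, because every earlier facet meets that facet inside the separator.
    Subtracting a multiple eliminates the last generator. *)
Lemma dual_exact1 (v : 'rV[R]_e) :
  v *m dual_gens = 0 -> exists w, v = w *m dual_syz.
Proof.
suff: forall t (v : 'rV[R]_e), (t <= e)%N ->
    (forall a : 'I_e, (t <= a)%N -> v 0 a = 0) -> v *m dual_gens = 0 ->
    exists w, v = w *m dual_syz.
  by move=> H v0; apply: (H e) => // a; rewrite leqNgt ltn_ord.
elim=> [|t IHt] {}v.
  move=> _ v0 _; exists 0; rewrite mul0mx; apply/rowP=> a; rewrite v0 ?mxE //.
move=> lt_te v0 vg0; pose ot := Ordinal lt_te.
have sum0 : \sum_(a < e) v 0 a * M (~: F a) = 0.
  move/matrixP/(_ 0 0): vg0; rewrite !mxE => {2}<-.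
  by apply: eq_bigr => a _; rewrite !mxE.
case: t => [|t] in IHt lt_te v0 ot *.
  have v_ot : v 0 ot = 0.
    move/eqP: sum0; rewrite (bigD1 ot) //= big1 ?addr0.
      by rewrite mulf_eq0 (negPf (mon_neq0 _)) orbF => /eqP.
    move=> a; rewrite -val_eqE /= => a0; rewrite v0 ?mul0r //; lia.
  apply: (IHt v) => // a _; case: (eqVneq a ot) => [->|] //.
  by rewrite -val_eqE /= => a0; rewrite v0 //; lia.
have lt_t : (t < e.-1)%N by lia.
pose m := Ordinal lt_t; have def_ot : ot = osucc m by apply: val_inj.
have [q def_q] : exists q, v 0 ot = q * M (F ot :\: Q m).
  apply: mon_dvd => u vu; apply/subsetPn => -[x]; rewrite inE => /andP[xQ xt] xu.
  have : (v 0 ot * M (~: F ot))@_(u + sqf_mon (~: F ot)) != 0.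
    by rewrite addmC mcoeffMX.
  move/eqP: sum0; rewrite (bigD1 ot) //= addr_eq0 => /eqP->.
  rewrite mcoeffN oppr_eq0 raddf_sum big1 ?eqxx //= => a ne_a.
  case: (ltnP t.+1 a) => [lt_ta|le_at]; first by rewrite v0 // mul0r mcoeff0.
  apply: coef_sqf_gen; apply/negP => /subsetP/(_ x).
  rewrite !inE mnmDE sqf_monE inE xt addn0.
  have lt_at : (a < m.+1)%N by move: ne_a; rewrite -val_eqE /=; lia.
  have /subsetP/(_ x) := sepP lt_at; rewrite inE xt (negPf xQ) /=.
  case: (x \in F a) => [/(_ isT)//|_ /(_ isT) ux].
  by case/negP: xu; rewrite inE.
have [|a le_ta||w wP] := IHt (v - q *: row m dual_syz); first by lia.
- have -> : (v - q *: row m dual_syz) 0 a = v 0 a - q * dual_syz m a by rewrite !mxE.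
  rewrite dual_syzE; case: (eqVneq a (osucc m)) => [->|ne_a].
    by rewrite -def_ot def_q subrr.
  rewrite v0; last by move: ne_a; rewrite -val_eqE /=; lia.
  case: eqP => [def_a|_]; last by rewrite mulr0 subr0.
  by have := p_lt m; rewrite -def_a /=; lia.
- by rewrite mulmxBl vg0 -scalemxAl -row_mul dual_syz_gens row0 scaler0 subr0.
exists (w + q *: delta_mx 0 m).
by rewrite mulmxDl -wP -scalemxAl -rowE subrK.
Qed.

(** The syzygy matrix is triangular: m + 1 is the largest index of a generator
    occurring in the m-th syzygy. *)
Lemma dual_syz_inj (v : 'rV[R]_e.-1) : v *m dual_syz = 0 -> v = 0.
Proof.
move=> v0; apply/rowP=> m0; rewrite mxE; apply/eqP/negPn/negP => vm0.
(* The largest m with v 0 m nonzero is the only one to contribute to the column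
   of index m + 1. *)
case: (@arg_maxnP _ m0 (fun m => v 0 m != 0) val) => // m vm maxm.
have := congr1 (fun A : 'rV_e => A 0 (osucc m)) v0; rewrite !mxE (bigD1 m) //= big1.
  rewrite addr0 dual_syzE eqxx => /eqP; rewrite mulf_eq0 (negPf vm).
  by rewrite (negPf (mon_neq0 _)).
move=> m' ne_m; case: (eqVneq (v 0 m') 0) => [->|vm']; first by rewrite mul0r.
have le_m' : (m' <= m)%N by apply: maxm.
have lt_m' : (m' < m)%N by rewrite ltn_neqAle le_m' andbT.
rewrite dual_syzE (_ : (osucc m == osucc m') = false); last first.
  by apply/negbTE; rewrite -val_eqE /= eqSS gtn_eqF.
case: eqP => [/(congr1 val) /= def_p|_]; last by rewrite mulr0.
by have := p_lt m'; rewrite -def_p; lia.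
Qed.

Lemma dual_mem (v : 'rV[R]_1) :
  SR_ideal Gamma (v 0 0) <-> exists w, v = w *m dual_gens.
Proof.
rewrite (SR_idealP _ dcG); split=> [v0|[w ->] u uG]; last first.
  rewrite mxE raddf_sum big1 //= => a _; rewrite mxE coef_sqf_gen //.
  apply/negP => sau; move: uG; apply/negP; rewrite GammaN.
  by apply/existsP; exists a.
have [|c def_v] := @sqf_ideal_memP K X _ predT (fun a : 'I_e => ~: F a) (v 0 0).
  move=> u vu; have : mon_supp u \notin Gamma by apply: contra vu => /v0->.
  by rewrite GammaN => /existsP[a sau]; exists a.
exists (\row_a c a); apply/matrixP=> i j; rewrite !ord1 def_v mxE.
by apply: eq_bigr => a _; rewrite !mxE.
Qed.

Definition dual_rank i := match i with 0 => 1%N | 1 => e | 2 => e.-1 | _ => 0%N end.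

Definition dual_deg i : 'I_(dual_rank i) -> int :=
  match i with
  | 0 => fun _ => 0
  | 1 => fun a => #|~: F a|%:Z
  | 2 => fun m => #|~: Q m|%:Z
  | _ => fun _ => 0
  end.

Definition dual_diff i : 'M[R]_(dual_rank i.+1, dual_rank i) :=
  match i with 0 => dual_gens | 1 => dual_syz | _ => 0 end.

Lemma homogeneous_mon A : homogeneous #|A|%:Z (M A).
Proof. by move=> u; rewrite msuppX inE => /eqP->; rewrite mdeg_sqf. Qed.

Lemma homogeneousN d (f : R) : homogeneous d f -> homogeneous d (- f).
Proof. by move=> hf u; rewrite (perm_mem (msuppN f)); apply: hf. Qed.

Lemma homogeneous0 d : homogeneous d (0 : R).
Proof. by move=> u; rewrite msupp0. Qed.

Lemma card_sep_diff m (b : 'I_e) : Q m \subset F b ->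
  #|~: Q m|%:Z - #|~: F b|%:Z = #|F b :\: Q m|%:Z.
Proof.
move=> sQF; have := cardsC (Q m); have := cardsC (F b); have := cardsD (F b) (Q m).
have := subset_leq_card sQF; rewrite (setIidPr sQF); lia.
Qed.

Lemma dual_diff_homog i a b :
  homogeneous (dual_deg a - dual_deg b) (dual_diff i a b).
Proof.
case: i a b => [|[|i]] a b /=; last by case: a.
  by rewrite subr0 mxE; apply: homogeneous_mon.
rewrite dual_syzE; case: eqP => [->|_].
  by rewrite card_sep_diff ?sep_sub_succ //; apply: homogeneous_mon.
case: eqP => [->|_]; last exact: homogeneous0.
rewrite card_sep_diff ?sep_sub_parent //; exact/homogeneousN/homogeneous_mon.
Qed.

Lemma mon_coef0 A : A != set0 -> (M A)@_0%MM = 0.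
Proof.
case/set0Pn=> x xA; rewrite mcoeffX; case: eqP => // A0.
by have := sqf_monE A x; rewrite A0 mnm0E xA.
Qed.

Lemma dual_minimal i a b : (dual_diff i a b)@_0%MM = 0.
Proof.
case: i a b => [|[|i]] a b /=; last by rewrite mxE mcoeff0.
  rewrite mxE mon_coef0 //; apply/negP => /eqP Fa.
  have [c ne_c] : exists c : 'I_e, c != a.
    case: (eqVneq (val a) 0%N) => a0.
      by exists (Ordinal e_gt1); rewrite -val_eqE /= a0.
    by exists (Ordinal (ltnW e_gt1)); rewrite -val_eqE /= eq_sym.
  case/eqP: ne_c; apply: antichain; rewrite -[F a]setCK Fa setC0.
  exact: subsetT.
have sep_neq (c c' : 'I_e) : c != c' -> Q a = F c :&: F c' -> F c :\: Q a != set0.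
  move=> ne_c ->; rewrite setD_eq0 subsetI subxx /=.
  by apply: contra ne_c => /antichain->.
rewrite dual_syzE; case: eqP => [_|_].
  by apply/mon_coef0/(sep_neq _ (p a)); rewrite ?sepE // eq_sym parent_neq.
case: eqP => [_|_]; last exact: mcoeff0.
rewrite mcoeffN mon_coef0 ?oppr0 // (sep_neq _ (osucc a)) ?parent_neq //.
by rewrite sepE setIC.
Qed.

Definition dual_res : min_graded_free_res (@SR_ideal X K Gamma).
Proof.
apply: (@MinGradedFreeRes K n _ dual_rank dual_deg (1%:M : 'M[R]_1) dual_diff).
- move=> a; rewrite ord1 mxE eqxx => u; rewrite mcoeff_msupp mcoeff1.
  by case: (u =P 0%MM) => [->|_]; rewrite ?mdeg0 // eqxx.
- exact: dual_diff_homog.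
- move=> f; exists (f%:M : 'M[R]_1); rewrite mulmx1 mxE eqxx subrr.
  by apply/(SR_idealP _ dcG) => u _; rewrite mcoeff0.
- by move=> v; rewrite mulmx1; apply: dual_mem.
- case=> [|[|i]] v /=.
  + split=> [/dual_exact1 //|[w ->]].
    by rewrite -mulmxA dual_syz_gens mulmx0.
  + split=> [/dual_syz_inj ->|[w ->]]; first by exists 0; rewrite mul0mx.
    by rewrite mulmx0 mul0mx.
  + by split=> _; [exists 0; rewrite mul0mx; apply/rowP; case | rewrite mulmx0].
- exact: dual_minimal.
Defined.

Lemma betti_dual_res2 d :
  betti dual_res 2 d = #|[set m : 'I_e.-1 | #|~: Q m|%:Z == d]|.
Proof. by []. Qed.

Lemma betti_dual_res_ge3 i d : betti dual_res i.+3 d = 0%N.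
Proof. by apply/eqP; rewrite cards_eq0; apply/eqP/setP; case. Qed.

End DualResolution.

(** * Betti numbers of a skeleton *)
Section BettiSkeleton.
Variables (K : fieldType) (X : finType) (Gamma Sigma : {set {set X}}) (s : nat).
Hypothesis dcG : down_closed Gamma.
Hypothesis SigmaE : forall B, (B \in Sigma) = (B \in Gamma) && (#|B| <= s)%N.
Variable F : min_graded_free_res (@SR_ideal X K Sigma).
Variable G : min_graded_free_res (@SR_ideal X K Gamma).
Let dcS := down_closed_skeleton dcG SigmaE.

(** In these degrees the squarefree strands around exterior degree i see only
    faces of cardinality at most s, on which the two complexes agree. *)
Lemma betti_skeleton_below i (d : int) : d - i%:Z < s%:Z -> betti F i d = betti G i d.
Proof.
move=> lt_ds; have := betti_rank dcS F i d; have := betti_rank dcG G i d.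
rewrite !(sqf_rank_skeleton K SigmaE) //; last by lia.
have -> : #|[pred AB | sqf_strand Sigma i d AB]| = #|[pred AB | sqf_strand Gamma i d AB]|.
  by apply: eq_card => AB; rewrite !inE (sqf_strand_skeleton SigmaE) // ltW.
by move=> <- /eqP; rewrite !eqn_add2r => /eqP.
Qed.

(** Here the squarefree strand itself is zero. *)
Lemma betti_skeleton_above i (d : int) : s%:Z < d - i%:Z -> betti F i d = 0%N.
Proof.
move=> lt_sd; have := betti_rank dcS F i d.
have -> : #|[pred AB | sqf_strand Sigma i d AB]| = 0%N; last by lia.
by apply: eq_card0 => AB; rewrite inE (sqf_strand_above SigmaE).
Qed.

Lemma betti_small i (d : nat) : (d < i)%N -> betti G i d = 0%N.
Proof.
move=> lt_di; have := betti_rank dcG G i d.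
have -> : #|[pred AB | sqf_strand Gamma i d AB]| = 0%N; last by lia.
apply: eq_card0 => AB; rewrite inE; apply/negP => /and3P[_ /eqP Ai /eqP]; lia.
Qed.

Hypothesis G_short : forall i d, (2 < i)%N -> betti G i d = 0%N.

(** In total degree i + s, the Betti numbers of the skeleton vanish below
    homological degree i, and agree with those of the larger complex above it.
    The Euler characteristic thus gives the one at i, up to those of homological
    degree greater than i, of which only beta_2 can survive, when i = 1. *)
Lemma betti_skeleton_top i : (0 < i)%N ->
  (betti F i (i + s)%N)%:Z =
    \sum_(u < s.+1) (-1) ^+ u *
       (#|[set B in Gamma | #|B| == (s - u)%N]| * 'C(#|X| - (s - u), i + u))%N%:Z
    + (i == 1%N)%:Z * (betti G 2 (i + s)%N)%:Z.
Proof.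
move=> i_gt0; have := betti_euler dcS F (i + s).
rewrite -addnS !big_split_ord /=.
rewrite [X in X + _ = _]big1 => [|p _]; last first.
  by rewrite betti_skeleton_above ?mulr0 //; have := ltn_ord p; lia.
rewrite [X in _ = X + _]big1 => [|p _]; last first.
  have -> : #|[pred AB | sqf_strand Sigma p (i + s)%N AB]| = 0%N; last by rewrite mulr0.
  apply: eq_card0 => AB; rewrite inE (sqf_strand_above SigmaE) //.
  by have := ltn_ord p; lia.
rewrite !add0r => euler.
have {}euler : \sum_(u < s.+1) (-1) ^+ u * (betti F (i + u) (i + s)%N)%:Z =
    \sum_(u < s.+1) (-1) ^+ u *
       (#|[set B in Gamma | #|B| == (s - u)%N]| * 'C(#|X| - (s - u), i + u))%N%:Z.
  apply: (can_inj (mulKr (unitrX i (unitrN1 _)))); rewrite !mulr_sumr.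
  transitivity (\sum_(u < s.+1) (-1) ^+ (i + u) * (betti F (i + u) (i + s)%N)%:Z).
    by apply: eq_bigr => u _; rewrite mulrA exprD.
  rewrite euler; apply: eq_bigr => u _; rewrite mulrA -exprD; congr (_ * _%:Z).
  have le_us : (u <= s)%N by rewrite -ltnS.
  rewrite (_ : i + s = i + u + (s - u))%N; last by lia.
  rewrite card_sqf_strand; congr (_ * _)%N; apply: eq_card => B.
  rewrite !inE SigmaE; case: eqP => [->|_]; rewrite ?andbF // !andbT.
  by rewrite leq_subr andbT.
rewrite -euler big_ord_recl /= expr0 mul1r addn0.
rewrite -[LHS]addr0 -addrA; congr (_ + _); apply/esym.
have tail u : (0 < u)%N -> betti F (i + u) (i + s)%N = betti G (i + u) (i + s)%N.
  by move=> u_gt0; apply: betti_skeleton_below; lia.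
case: (eqVneq i 1%N) => [i1|i_neq1]; last first.
  rewrite mul0r addr0 big1 // => u _; rewrite tail // G_short ?mulr0 //=.
  by rewrite /bump /=; lia.
rewrite mul1r; case: (s) (tail) => [|s'] tl.
  by rewrite big_ord0 add0r betti_small // i1.
rewrite big_ord_recl /= tl // big1 => [|u _].
  by rewrite i1 /bump /= expr1 addr0 mulN1r addNr.
by rewrite tl // G_short ?mulr0 // /bump /=; lia.
Qed.

End BettiSkeleton.

(** * Clique complexes, their facets and their duals *)
Section CliqueComplex.
Variables (X : finType) (adj : rel X) (S : seq {set X}).
Local Notation Delta := (clique_complex adj).

Lemma down_closed_clique : down_closed Delta.
Proof.
move=> A B /subsetP sAB; rewrite !inE => /forall_inP cB.
apply/forall_inP=> x /sAB xB; apply/forall_inP=> y /sAB yB.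
by have /forall_inP := cB x xB; apply.
Qed.

Lemma down_closed_dual (Sigma : {set {set X}}) :
  down_closed Sigma -> down_closed (alexander_dual Sigma).
Proof.
move=> dcS A B sAB; rewrite !inE; apply: contra; apply: dcS.
by rewrite setCS.
Qed.

Hypothesis S_facets : S =i facets Delta.

Lemma mem_facets_cover C :
  (C \in Delta) = [exists a : 'I_(size S), C \subset nth set0 S a].
Proof.
apply/idP/existsP => [|[a sCa]]; last first.
  apply: down_closed_clique sCa _.
  have : nth set0 S a \in S by rewrite mem_nth.
  by rewrite S_facets inE => /maxsetp.
move=> CD; have [M maxM sCM] := maxset_exists (P := mem Delta) CD.
have MS : M \in S by rewrite S_facets inE.
have ltM : (index M S < size S)%N by rewrite index_mem.
by exists (Ordinal ltM); rewrite /= nth_index.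
Qed.

Lemma facets_antichain (a b : 'I_(size S)) : uniq S ->
  nth set0 S a \subset nth set0 S b -> a = b.
Proof.
move=> uS sab; apply: val_inj; apply/eqP => /=.
rewrite -(nth_uniq set0 _ _ uS) ?ltn_ord //; apply/eqP/esym.
have : nth set0 S a \in S by rewrite mem_nth.
have : nth set0 S b \in S by rewrite mem_nth.
rewrite !S_facets !inE => /maxsetp bD maxa.
exact: (maxsetsup maxa).
Qed.

End CliqueComplex.

Lemma card_dual_faces (X : finType) (Delta : {set {set X}}) q : (q <= #|X|)%N ->
  (#|[set B in alexander_dual Delta | #|B| == q]|
     + #|[set C in Delta | #|C| == (#|X| - q)%N]|)%N = 'C(#|X|, #|X| - q).
Proof.
move=> le_q; rewrite (bin_sub le_q) -cardsT -cards_draws.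
rewrite -[RHS](cardsID (alexander_dual Delta)) cardsT.
congr (_ + _)%N; first by apply: eq_card => B; rewrite !inE subsetT andbC.
rewrite -(card_imset _ (can_inj (@setCK X))); apply: eq_card => B.
rewrite !inE negbK subsetT /=; apply/imsetP/andP => [[C]|[BD /eqP Bq]].
  rewrite inE => /andP[CD /eqP Cq] ->; rewrite setCK; split=> //.
  by rewrite -(eqn_add2l #|C|) cardsC Cq subnK.
exists (~: B); rewrite ?setCK // inE BD /=.
by rewrite -(eqn_add2l #|B|) cardsC Bq subnKC.
Qed.

(** * Skeleta of the dual of a chordal clique complex *)
Theorem theorem5 (K : fieldType) (X : finType) (adj : rel X)
    (S : seq {set X}) (k : int)
    (adj_graph : simple_graph adj) (adj_chordal : chordal adj)
    (two_facets : (2 <= #|facets (clique_complex adj)|)%N)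
    (S_leaf : leaf_order (clique_complex adj) S)
    (k_ge : -1 <= k) (k_lt : k < #|X|%:Z - 3)
    (F : min_graded_free_res
           (@SR_ideal X K (skeleton (alexander_dual (clique_complex adj)) k))) :
  let N : int := #|X|%:Z in
  let n (m : nat) : int := #|nth set0 S m|%:Z in
  let r (m : nat) : int := #|separator S m|%:Z in
  [/\ forall (G : min_graded_free_res
                   (@SR_ideal X K (alexander_dual (clique_complex adj))))
             (i : nat) (j : int), j < k + 1 ->
        betti F i (i%:Z + j) = betti G i (i%:Z + j),
      forall (i : nat) (j : int), k + 1 < j ->
        betti F i (i%:Z + j) = 0%N
    & forall i : nat, (1 <= i)%N ->
        (betti F i (i%:Z + k + 1))%:Z =
          (binomz N (i%:Z + k + 1))%:Z * (binomz (i%:Z + k) (k + 1))%:Z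
          - \sum_(m < size S)
              (binomz (n m) (N - i%:Z - k - 1))%:Z
              * (binomz (n m - N + i%:Z + k) (i%:Z - 1))%:Z
          + \sum_(m < (size S).-1)
              (binomz (r m) (N - i%:Z - k - 1))%:Z
              * (binomz (r m - N + i%:Z + k) (i%:Z - 1))%:Z
          + (i == 1%N)%:Z
            * #|[set m : 'I_(size S).-1 | N - r m == k + 2]|%:Z].
Proof.
case: S_leaf => uS S_facets leafP; set Delta := clique_complex adj.
set Gamma := alexander_dual Delta => N n r.
have dcG : down_closed Gamma by apply/down_closed_dual/down_closed_clique.
have [s def_k] : exists s : nat, k = s%:Z - 1 by exists (absz (k + 1)); lia.
have SigmaE B : (B \in skeleton Gamma k) = (B \in Gamma) && (#|B| <= s)%N.
  by rewrite inE /face_dim def_k; congr (_ && _); lia.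
split=> [G i j lt_j|i j lt_j|i i_gt0].
- by apply: (betti_skeleton_below dcG SigmaE); lia.
- by apply: (betti_skeleton_above dcG SigmaE); lia.
have e_gt1 : (1 < size S)%N.
  by rewrite -(card_uniqP uS) (eq_card S_facets).
have antichain (a b : 'I_(size S)) : nth set0 S a \subset nth set0 S b -> a = b.
  exact: facets_antichain.
have cover := mem_facets_cover S_facets.
have /fin_all_exists2[p p_lt sepE] (m : 'I_(size S).-1) :
    exists2 p : 'I_(size S), (p < m.+1)%N
      & separator S m = nth set0 S m.+1 :&: nth set0 S p.
  have lt_m : (m.+1 < size S)%N by have := ltn_ord m; lia.
  have [p lt_p def_Q] := separator_parent leafP lt_m.
  by exists (Ordinal (ltn_trans lt_p lt_m)).
have sepP (m : 'I_(size S).-1) j : (j < m.+1)%N ->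
    nth set0 S m.+1 :&: nth set0 S j \subset separator S m.
  move=> lt_j; have lt_m : (m.+1 < size S)%N by have := ltn_ord m; lia.
  rewrite (separatorP leafP) // subsetIl; apply/existsP.
  by exists (Ordinal lt_j); apply: subsetIr.
have GammaN B : (B \notin Gamma) = [exists a : 'I_(size S), ~: nth set0 S a \subset B].
  rewrite inE negbK cover; apply: eq_existsb => a.
  by rewrite -setCS setCK.
(* The Betti numbers of the dual beyond homological degree 1 are read off the
   explicit resolution. *)
pose G := dual_res K dcG GammaN antichain e_gt1 p_lt sepE sepP.
have G_short q d : (2 < q)%N -> betti G q d = 0%N.
  by case: q => [|[|[|q]]] // _; apply: betti_dual_res_ge3.
have := betti_skeleton_top dcG SigmaE F G_short i_gt0.
have -> : (i + s)%N%:Z = i%:Z + k + 1 by lia.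
move=> ->; congr (_ + _); last first.
  rewrite betti_dual_res2; case: eqP => [->|_]; rewrite ?mul0r // !mul1r; congr _%:Z.
  apply: eq_card => m; rewrite !inE /r /N.
  by have := cardsC (separator S m); lia.
have le_sN : (s <= #|X|)%N by lia.
have faces q : (q <= #|X|)%N -> #|[set B in Gamma | #|B| == q]|%:Z =
    'C(#|X|, #|X| - q)%:Z - \sum_(m < size S) 'C(#|nth set0 S m|, #|X| - q)%:Z
    + \sum_(m < (size S).-1) 'C(#|separator S m|, #|X| - q)%:Z.
  move=> le_q; rewrite -(card_dual_faces Delta le_q).
  have := card_faces leafP (#|X| - q)%N (e := size S).
  rewrite leqnn (ltnW e_gt1) => /(_ isT) /(congr1 Posz).
  rewrite PoszD !(big_morph Posz PoszD (erefl _)) => <-.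
  have -> : #|[set C in Delta | #|C| == (#|X| - q)%N]| =
    #|[set C : {set X} | [exists a : 'I_(size S), C \subset nth set0 S a]
         & #|C| == (#|X| - q)%N]|.
    by apply: eq_card => C; rewrite !inE -cover inE.
  rewrite PoszD; ring.
(* The full simplex, each facet and each separator are all treated by the same
   binomial identity. *)
have contrib n' : (n' <= #|X|)%N ->
    \sum_(u < s.+1) (-1) ^+ u *
      ('C(n', #|X| - (s - u)) * 'C(#|X| - (s - u), i + u))%N%:Z =
    (binomz n' (N - i%:Z - k - 1))%:Z * (binomz (n'%:Z - N + i%:Z + k) (i%:Z - 1))%:Z.
  move=> le_n'; rewrite simplex_contribution //; congr ((binomz _ _)%:Z * (binomz _ _)%:Z).
    by rewrite /N; lia.
  by rewrite /N; lia.
transitivity (\sum_(u < s.+1) ((-1) ^+ u *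
      ('C(#|X|, #|X| - (s - u)) * 'C(#|X| - (s - u), i + u))%N%:Z
   - \sum_(m < size S) (-1) ^+ u *
      ('C(#|nth set0 S m|, #|X| - (s - u)) * 'C(#|X| - (s - u), i + u))%N%:Z
   + \sum_(m < (size S).-1) (-1) ^+ u *
      ('C(#|separator S m|, #|X| - (s - u)) * 'C(#|X| - (s - u), i + u))%N%:Z)).
  apply: eq_bigr => u _; rewrite PoszM faces; last by lia.
  rewrite mulrDl mulrBl mulrDr mulrBr !mulr_suml !mulr_sumr PoszM.
  by congr (_ - _ + _); apply: eq_bigr => m _; rewrite PoszM.
rewrite !big_split /= sumrN; congr (_ - _ + _).
- rewrite contrib // subrr add0r.
  case: (leqP (i + s) #|X|) => [le_is|lt_is]; last first.
    have -> : N - i%:Z - k - 1 = Negz ((i + s) - #|X|).-1 by rewrite /N; lia.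
    have -> : i%:Z + k + 1 = (i + s)%N%:Z by lia.
    by rewrite /binomz /N bin_small.
  have -> : N - i%:Z - k - 1 = (#|X| - (i + s))%N%:Z by rewrite /N; lia.
  have -> : i%:Z + k + 1 = (i + s)%N%:Z by lia.
  have -> : i%:Z + k = (i.-1 + s)%N%:Z by lia.
  have -> : i%:Z - 1 = i.-1%:Z by lia.
  have -> : k + 1 = s by lia.
  by rewrite /binomz /N bin_sub // -(bin_sub (leq_addl i.-1 s)) addnK.
- rewrite exchange_big /=; apply: eq_bigr => m _; exact/contrib/max_card.
- rewrite exchange_big /=; apply: eq_bigr => m _; exact/contrib/max_card.
Qed.
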